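(* Let $M$ be a contact $CR$-lightlike submanifold of an indefinite Kenmotsu statistical manifold $(\bar M,\bar\nabla,\bar\nabla^{*},\bar g,\phi,\nu)$. Then $D\perp\{\nu\}$ is integrable if and only if $$h(X,\phi Y)+h^{*}(X,\phi Y)=h(Y,\phi X)+h^{*}(Y,\phi X)$$ for all $X,Y\in\Gamma(D\perp\{\nu\})$.
   Context: Indefinite Kenmotsu statistical manifold $(\bar M,\bar\nabla,\bar\nabla^{*},\bar g,\phi,\nu)$: $\bar M$ is a $(2n+1)$-dimensional manifold with a semi-Riemannian metric $\bar g$ of constant index $q\ge1$, a torsion-free affine connection $\bar\nabla$ with $(\bar\nabla_X\bar g)(Y,Z)=(\bar\nabla_Y\bar g)(X,Z)$, dual connection $\bar\nabla^{*}$ defined by $X\bar g(Y,Z)=\bar g(\bar\nabla_XY,Z)+\bar g(Y,\bar\nabla^{*}_XZ)$, Levi-Civita connection $\widehat{\bar\nabla}=\frac12(\bar\nabla+\bar\nabla^{*})$, and $K(X,Y)=\bar\nabla_XY-\widehat{\bar\nabla}_XY$. It carries a $(1,1)$-tensor field $\phi$, a vector field $\nu$ and a $1$-form $\eta$ with $\bar g(\phi X,\phi Y)=\bar g(X,Y)-\eta(X)\eta(Y)$, $\bar g(\nu,\nu)=1$, $\phi^2X=-X+\eta(X)\nu$, $\bar g(X,\nu)=\eta(X)$, $\bar g(\phi X,Y)+\bar g(X,\phi Y)=0$, satisfying $(\widehat{\bar\nabla}_X\phi)Y=\eta(Y)\phi X-\bar g(\phi X,Y)\nu$, $\widehat{\bar\nabla}_X\nu=-X+\eta(X)\nu$,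 and $K(X,\phi Y)=-\phi K(X,Y)$, for all vector fields $X,Y,Z$ on $\bar M$. Lightlike submanifold: a submanifold $M$ of $\bar M$ with degenerate induced metric $g$ such that $Rad(TM)=TM\cap TM^{\perp}$ is a distribution of rank $r\ge1$. $S(TM)$ (screen distribution) is a chosen complement of $Rad(TM)$ in $TM$, $TM=Rad(TM)\perp S(TM)$; $S(TM^{\perp})$ (screen transversal bundle) is a chosen complement of $Rad(TM)$ in $TM^\perp$. The lightlike transversal bundle $ltr(TM)$ is locally spanned by sections $N_i$ of the orthogonal complement of $S(TM^\perp)$ in $S(TM)^\perp$ with $\bar g(\xi_i,N_j)=\delta_{ij}$, $\bar g(N_i,N_j)=0$ for a local basis $\{\xi_i\}$ of $Rad(TM)$. Put $tr(TM)=ltr(TM)\perp S(TM^\perp)$, so $T\bar M|_M=TM\oplus tr(TM)$. For $X,Y\in\Gamma(TM)$ write $\bar\nabla_XY=\nabla_XY+h(X,Y)$ and $\bar\nabla^{*}_XY=\nabla^{*}_XY+h^{*}(X,Y)$ with $\nabla_XY,\nabla^*_XY\in\Gamma(TM)$ and $h(X,Y),h^{*}(X,Y)\in\Gamma(tr(TM))$. Contact $CR$-lightlike submanifold: a lightlike submanifold $M$ tangent to $\nu$ such that (1) $Rad(TM)\cap\phi(Rad(TM))=\{0\}$, with $\phi(Rad(TM))$ a distribution on $M$; (2) there are vector bundles $D_0$, $D'$ over $M$ with $S(TM)=\{\phi(Rad(TM))\oplus D'\}\perp D_0\perp\{\nu\}$, $\phi D_0=D_0$, $\phi(D')=L_1\perp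 ltr(TM)$, where $D_0$ is non-degenerate and $L_1$ is a vector subbundle of $S(TM^\perp)$. Put $D=Rad(TM)\perp\phi(Rad(TM))\perp D_0$, so $TM=D\oplus D'\perp\{\nu\}$. *)

(* Defs.v *)
From HB Require Import structures.
From mathcomp Require Import all_boot all_order all_algebra.
From mathcomp Require Import all_classical all_reals all_analysis.
Set Implicit Arguments.
Unset Strict Implicit.
Unset Printing Implicit Defensive.
Import Order.TTheory GRing.Theory Num.Theory.
Import numFieldNormedType.Exports.
Local Open Scope classical_set_scope.
Local Open Scope ring_scope.

Fixpoint iterD (R : realType) (V W : normedModType R) (vs : seq V)
    (F : V -> W) : V -> W :=
  if vs is v :: vs' then iterD vs' (fun x => 'D_v F x) else F.

(* C^infinity on the open set A: every iterated directional derivative is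
   differentiable at every point of A. *)
Definition smooth_on (R : realType) (V W : normedModType R) (A : set V)
    (F : V -> W) : Prop :=
  forall (vs : seq V) (x : V), A x -> differentiable (iterD vs F) x.

(* [cmap] and [cinv] are total functions; they are meaningful only on [cdom]
   and on its image respectively. *)
Record chart (R : realType) (T : topologicalType) (m : nat) := Chart {
  cdom : set T;
  cmap : T -> 'rV[R]_m;
  cinv : 'rV[R]_m -> T;
  cdom_open : open cdom;
  cimage_open : open (cmap @` cdom);
  cmapK : forall p, cdom p -> cinv (cmap p) = p;
  cmap_continuous : {within cdom, continuous cmap};
  cinv_continuous : {within cmap @` cdom, continuous cinv}
}.

(* The smooth structure is given by an atlas indexed by the points, so that
   each point p comes with a preferred chart [chart_at p] around it. *)
Record manifold (R : realType) (m : nat) := Manifold {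
  carrier :> topologicalType;
  chart_at : carrier -> chart R carrier m;
  manifold_hausdorff : hausdorff_space carrier;
  manifold_second_countable : @second_countable carrier;
  mem_chart_at : forall p, cdom (chart_at p) p;
  chart_compatible : forall p q,
    smooth_on (cmap (chart_at p) @` (cdom (chart_at p) `&` cdom (chart_at q)))
              (cmap (chart_at q) \o cinv (chart_at p))
}.

(* The tangent space T_pM is 'rV[R]_m: a tangent vector at p is represented by
   its components in the preferred chart [chart_at p]. [tcoord p q] converts
   these into components in the chart [chart_at q]. *)
Definition tcoord (R : realType) (m : nat) (M : manifold R m) (q p : M) :
    'rV[R]_m -> 'rV[R]_m :=
  'd (cmap (chart_at q) \o cinv (chart_at p)) (cmap (chart_at p) p).

(* Smoothness on the open set U. *)
Definition smooth_fun (R : realType) (m : nat) (M : manifold R m)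
    (W : normedModType R) (U : set M) (F : M -> W) : Prop :=
  forall q : M,
    smooth_on (cmap (chart_at q) @` (cdom (chart_at q) `&` U))
              (F \o cinv (chart_at q)).

Definition smooth_map (R : realType) (k m : nat) (M : manifold R k)
    (N : manifold R m) (f : M -> N) : Prop :=
  continuous f /\
  forall q : N,
    smooth_fun (f @^-1` cdom (chart_at q)) (cmap (chart_at q) \o f).

(* The differential T_pM -> T_{f p}N. *)
Definition tmap (R : realType) (k m : nat) (M : manifold R k)
    (N : manifold R m) (f : M -> N) (p : M) : 'Hom('rV[R]_k, 'rV[R]_m) :=
  linfun ('d (cmap (chart_at (f p)) \o f \o cinv (chart_at p))
             (cmap (chart_at p) p)).

Definition submanifold (R : realType) (k m : nat) (M : manifold R k)
    (N : manifold R m) (f : M -> N) : Prop :=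
  [/\ smooth_map f, injective f & forall p, injective (tmap f p)].

(* Sections of f^*TN over the open set U: s p is a vector of T_{f p}N. *)
Definition smooth_section (R : realType) (k m : nat) (M : manifold R k)
    (N : manifold R m) (f : M -> N) (U : set M) (s : M -> 'rV[R]_m) : Prop :=
  forall q : N,
    smooth_fun (U `&` f @^-1` cdom (chart_at q))
               (fun p => tcoord q (f p) (s p)).

Definition smooth_vf (R : realType) (m : nat) (M : manifold R m)
    (X : M -> 'rV[R]_m) : Prop :=
  smooth_section (fun p : M => p) setT X.

Definition vf_act (R : realType) (m : nat) (M : manifold R m)
    (X : M -> 'rV[R]_m) (a : M -> R^o) (p : M) : R :=
  'D_(X p) (a \o cinv (chart_at p)) (cmap (chart_at p) p).

(* The vector field X read in the chart [chart_at q]. *)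
Definition vf_in_chart (R : realType) (m : nat) (M : manifold R m) (q : M)
    (X : M -> 'rV[R]_m) (x : 'rV[R]_m) : 'rV[R]_m :=
  let p := cinv (chart_at q) x in tcoord q p (X p).

(* [X, Y]^i = X^j d_j Y^i - Y^j d_j X^i, in the preferred chart at p. *)
Definition lie_bracket (R : realType) (m : nat) (M : manifold R m)
    (X Y : M -> 'rV[R]_m) (p : M) : 'rV[R]_m :=
  'D_(X p) (vf_in_chart p Y) (cmap (chart_at p) p)
  - 'D_(Y p) (vf_in_chart p X) (cmap (chart_at p) p).

(* A linear connection on the bundle f^*TN over M. *)
Record connection_along (R : realType) (k m : nat) (M : manifold R k)
    (N : manifold R m) (f : M -> N)
    (D : (M -> 'rV[R]_k) -> (M -> 'rV[R]_m) -> M -> 'rV[R]_m) : Prop := {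
  conn_smooth : forall X s, smooth_vf X -> smooth_section f setT s ->
    smooth_section f setT (D X s);
  conn_addl : forall X Y s, smooth_vf X -> smooth_vf Y ->
    smooth_section f setT s ->
    forall p, D (fun q => X q + Y q) s p = D X s p + D Y s p;
  conn_scalel : forall (a : M -> R^o) X s, smooth_fun setT a -> smooth_vf X ->
    smooth_section f setT s ->
    forall p, D (fun q => a q *: X q) s p = a p *: D X s p;
  conn_addr : forall X s t, smooth_vf X -> smooth_section f setT s ->
    smooth_section f setT t ->
    forall p, D X (fun q => s q + t q) p = D X s p + D X t p;
  conn_leibniz : forall (a : M -> R^o) X s, smooth_fun setT a -> smooth_vf X ->
    smooth_section f setT s ->
    forall p, D X (fun q => a q *: s q) p
              = vf_act X a p *: s p + a p *: D X s p
}.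

Definition affine_connection (R : realType) (m : nat) (N : manifold R m)
    (nab : (N -> 'rV[R]_m) -> (N -> 'rV[R]_m) -> N -> 'rV[R]_m) : Prop :=
  connection_along (fun p : N => p) nab.

(* D is the connection on f^*TN induced by the affine connection nab of N:
   D_X (V o f) = nab_{f_*X} V. This determines D, and gives its meaning to
   nab_X Y when X is tangent to M and Y is a vector field of N along M. *)
Record induced_connection (R : realType) (k m : nat) (M : manifold R k)
    (N : manifold R m) (f : M -> N)
    (nab : (N -> 'rV[R]_m) -> (N -> 'rV[R]_m) -> N -> 'rV[R]_m)
    (D : (M -> 'rV[R]_k) -> (M -> 'rV[R]_m) -> M -> 'rV[R]_m) : Prop := {
  induced_conn : connection_along f D;
  induced_compat : forall X V W, smooth_vf X -> smooth_vf V -> smooth_vf W ->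
    forall p, W (f p) = tmap f p (X p) -> D X (V \o f) p = nab W V (f p)
}.

(* A smooth subbundle of rank r of f^*TN. *)
Definition subbundle (R : realType) (k m : nat) (M : manifold R k)
    (N : manifold R m) (f : M -> N) (r : nat)
    (E : M -> {vspace 'rV[R]_m}) : Prop :=
  forall p : M, exists (U : set M) (s : 'I_r -> M -> 'rV[R]_m),
    [/\ open U, U p, forall i, smooth_section f U (s i)
      & forall q, U q -> basis_of (E q) [seq s i q | i <- enum 'I_r]].

Definition tangent_bundle (R : realType) (k m : nat) (M : manifold R k)
    (N : manifold R m) (f : M -> N) (p : M) : {vspace 'rV[R]_m} :=
  limg (tmap f p).

(* X is a smooth vector field on M, i.e. a section of TM, with values in E,
   where E is a subbundle of TM seen inside f^*TN. *)
Definition section_in (R : realType) (k m : nat) (M : manifold R k)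
    (N : manifold R m) (f : M -> N) (E : M -> {vspace 'rV[R]_m})
    (X : M -> 'rV[R]_k) : Prop :=
  smooth_vf X /\ forall p, tmap f p (X p) \in E p.

(* Integrable = closed under the Lie bracket (Frobenius), not "admits integral
   manifolds". The smoothness of [X, Y] is automatic. *)
Definition integrable_distribution (R : realType) (k m : nat)
    (M : manifold R k) (N : manifold R m) (f : M -> N)
    (E : M -> {vspace 'rV[R]_m}) : Prop :=
  forall X Y, section_in f E X -> section_in f E Y ->
    forall p, tmap f p (lie_bracket X Y p) \in E p.

Notation bilinear_form R m := 'Hom('rV[R]_m, 'Hom('rV[R]_m, R^o)).

Definition orthogonal_spaces (R : realType) (m : nat) (g : bilinear_form R m)
    (U V : {vspace 'rV[R]_m}) : Prop :=
  forall u v, u \in U -> v \in V -> g u v = 0.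

(* U^perp = {v | g(u, v) = 0 for all u in U} *)
Definition perp (R : realType) (m : nat) (g : bilinear_form R m)
    (U : {vspace 'rV[R]_m}) : {vspace 'rV[R]_m} :=
  (\bigcap_(u <- vbasis U) lker (g u))%VS.

Definition nondegenerate_on (R : realType) (m : nat) (g : bilinear_form R m)
    (U : {vspace 'rV[R]_m}) : Prop :=
  (U :&: perp g U)%VS = 0%VS.

Definition negative_on (R : realType) (m : nat) (g : bilinear_form R m)
    (U : {vspace 'rV[R]_m}) : Prop :=
  forall u, u \in U -> u != 0 -> g u u < 0.

Definition form_index (R : realType) (m : nat) (g : bilinear_form R m)
    (q : nat) : Prop :=
  (exists2 U : {vspace 'rV[R]_m}, negative_on g U & \dim U = q) /\
  forall U : {vspace 'rV[R]_m}, negative_on g U -> (\dim U <= q)%N.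

Definition orth_direct_sum (R : realType) (m : nat) (g : bilinear_form R m)
    (E U V : {vspace 'rV[R]_m}) : Prop :=
  [/\ E = (U + V)%VS, (U :&: V)%VS = 0%VS & orthogonal_spaces g U V].

Record semi_riemannian_metric (R : realType) (m : nat) (N : manifold R m)
    (q : nat) (g : N -> bilinear_form R m) : Prop := {
  metric_smooth : forall X Y, smooth_vf X -> smooth_vf Y ->
    smooth_fun setT (fun p => g p (X p) (Y p));
  metric_sym : forall p u v, g p u v = g p v u;
  metric_nondegenerate : forall p, nondegenerate_on (g p) fullv;
  metric_index : forall p, form_index (g p) q
}.

(* (nab_X g)(Y, Z) *)
Definition nabla_metric (R : realType) (m : nat) (N : manifold R m)
    (nab : (N -> 'rV[R]_m) -> (N -> 'rV[R]_m) -> N -> 'rV[R]_m)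
    (g : N -> bilinear_form R m) (X Y Z : N -> 'rV[R]_m) (p : N) : R :=
  vf_act X (fun q => g q (Y q) (Z q)) p
  - g p (nab X Y p) (Z p) - g p (Y p) (nab X Z p).

(* nabs is the dual connection of nab. *)
Record statistical_structure (R : realType) (m : nat) (N : manifold R m)
    (g : N -> bilinear_form R m)
    (nab nabs : (N -> 'rV[R]_m) -> (N -> 'rV[R]_m) -> N -> 'rV[R]_m) :
    Prop := {
  stat_conn : affine_connection nab;
  stat_torsion_free : forall X Y, smooth_vf X -> smooth_vf Y ->
    forall p, nab X Y p - nab Y X p = lie_bracket X Y p;
  stat_codazzi : forall X Y Z, smooth_vf X -> smooth_vf Y -> smooth_vf Z ->
    forall p, nabla_metric nab g X Y Z p = nabla_metric nab g Y X Z p;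
  stat_conn_dual : affine_connection nabs;
  stat_dual : forall X Y Z, smooth_vf X -> smooth_vf Y -> smooth_vf Z ->
    forall p, vf_act X (fun q => g q (Y q) (Z q)) p
              = g p (nab X Y p) (Z p) + g p (Y p) (nabs X Z p)
}.

Definition levi_civita (R : realType) (m : nat) (N : manifold R m)
    (nab nabs : (N -> 'rV[R]_m) -> (N -> 'rV[R]_m) -> N -> 'rV[R]_m)
    (X Y : N -> 'rV[R]_m) (p : N) : 'rV[R]_m :=
  2^-1 *: (nab X Y p + nabs X Y p).

Definition difference_tensor (R : realType) (m : nat) (N : manifold R m)
    (nab nabs : (N -> 'rV[R]_m) -> (N -> 'rV[R]_m) -> N -> 'rV[R]_m)
    (X Y : N -> 'rV[R]_m) (p : N) : 'rV[R]_m :=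
  nab X Y p - levi_civita nab nabs X Y p.

Definition act_on (R : realType) (m : nat) (T : Type)
    (phi : T -> 'End('rV[R]_m)) (X : T -> 'rV[R]_m) (p : T) : 'rV[R]_m :=
  phi p (X p).

Record almost_contact_metric (R : realType) (m : nat) (N : manifold R m)
    (g : N -> bilinear_form R m) (phi : N -> 'End('rV[R]_m))
    (nu : N -> 'rV[R]_m) (eta : N -> 'Hom('rV[R]_m, R^o)) : Prop := {
  phi_smooth : forall X, smooth_vf X -> smooth_vf (act_on phi X);
  nu_smooth : smooth_vf nu;
  eta_smooth : forall X, smooth_vf X -> smooth_fun setT (fun p => eta p (X p));
  phi_metric : forall p u v,
    g p (phi p u) (phi p v) = g p u v - eta p u * eta p v;
  nu_unit : forall p, g p (nu p) (nu p) = 1;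
  phi_sq : forall p u, phi p (phi p u) = - u + eta p u *: nu p;
  eta_dual : forall p u, g p u (nu p) = eta p u;
  phi_skew : forall p u v, g p (phi p u) v + g p u (phi p v) = 0
}.

Record indefinite_kenmotsu_statistical (R : realType) (n : nat)
    (N : manifold R n.*2.+1) (q : nat)
    (g : N -> bilinear_form R n.*2.+1)
    (nab nabs : (N -> 'rV[R]_n.*2.+1) -> (N -> 'rV[R]_n.*2.+1) ->
                N -> 'rV[R]_n.*2.+1)
    (phi : N -> 'End('rV[R]_n.*2.+1)) (nu : N -> 'rV[R]_n.*2.+1)
    (eta : N -> 'Hom('rV[R]_n.*2.+1, R^o)) : Prop := {
  ks_index_ge1 : (1 <= q)%N;
  ks_metric : semi_riemannian_metric q g;
  ks_statistical : statistical_structure g nab nabs;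
  ks_contact : almost_contact_metric g phi nu eta;
  ks_nabla_phi : forall X Y, smooth_vf X -> smooth_vf Y -> forall p,
    levi_civita nab nabs X (act_on phi Y) p
      - phi p (levi_civita nab nabs X Y p)
    = eta p (Y p) *: phi p (X p) - g p (phi p (X p)) (Y p) *: nu p;
  ks_nabla_nu : forall X, smooth_vf X -> forall p,
    levi_civita nab nabs X nu p = - X p + eta p (X p) *: nu p;
  ks_difference : forall X Y, smooth_vf X -> smooth_vf Y -> forall p,
    difference_tensor nab nabs X (act_on phi Y) p
    = - phi p (difference_tensor nab nabs X Y p)
}.

(* All bundles over M below are families of subspaces of T_{f p}N; the tangent
   bundle TM is identified with its image under the differential of f. *)

Definition normal_bundle (R : realType) (k m : nat) (M : manifold R k)
    (N : manifold R m) (f : M -> N) (g : N -> bilinear_form R m) (p : M) :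
    {vspace 'rV[R]_m} :=
  perp (g (f p)) (tangent_bundle f p).

Definition radical (R : realType) (k m : nat) (M : manifold R k)
    (N : manifold R m) (f : M -> N) (g : N -> bilinear_form R m) (p : M) :
    {vspace 'rV[R]_m} :=
  (tangent_bundle f p :&: normal_bundle f g p)%VS.

(* scr = S(TM), str = S(TM^perp) *)
Definition lightlike_transversal (R : realType) (k m : nat) (M : manifold R k)
    (N : manifold R m) (f : M -> N) (g : N -> bilinear_form R m) (r : nat)
    (scr str ltr : M -> {vspace 'rV[R]_m}) : Prop :=
  forall p : M, exists (U : set M) (xi nn : 'I_r -> M -> 'rV[R]_m),
    [/\ open U, U p,
        forall i, smooth_section f U (xi i) /\ smooth_section f U (nn i)
      & forall q, U q ->
        [/\ basis_of (radical f g q) [seq xi i q | i <- enum 'I_r],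
            ltr q = <<[seq nn i q | i <- enum 'I_r]>>%VS,
            forall i, nn i q \in
              (perp (g (f q)) (scr q) :&: perp (g (f q)) (str q))%VS
          & forall i j, g (f q) (xi i q) (nn j q) = (i == j)%:R /\
                        g (f q) (nn i q) (nn j q) = 0]].

Record lightlike_submanifold (R : realType) (k m : nat) (M : manifold R k)
    (N : manifold R m) (f : M -> N) (g : N -> bilinear_form R m) (r : nat)
    (scr str ltr : M -> {vspace 'rV[R]_m}) : Prop := {
  ll_submanifold : submanifold f;
  ll_rank_ge1 : (1 <= r)%N;
  ll_radical : subbundle f r (radical f g);
  ll_screen_bundle : exists d, subbundle f d scr;
  ll_screen : forall p,
    orth_direct_sum (g (f p)) (tangent_bundle f p) (radical f g p) (scr p);
  ll_screen_transversal_bundle : exists d, subbundle f d str;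
  ll_screen_transversal : forall p,
    orth_direct_sum (g (f p)) (normal_bundle f g p) (radical f g p) (str p);
  ll_transversal : lightlike_transversal f g r scr str ltr
}.

Definition transversal_bundle (R : realType) (m : nat) (T : Type)
    (str ltr : T -> {vspace 'rV[R]_m}) (p : T) : {vspace 'rV[R]_m} :=
  (ltr p + str p)%VS.

(* The component in tr(TM), along TM, of D_X Y; Y is a section of TM seen as a
   vector field along f. *)
Definition second_form (R : realType) (k m : nat) (M : manifold R k)
    (N : manifold R m) (f : M -> N) (str ltr : M -> {vspace 'rV[R]_m})
    (D : (M -> 'rV[R]_k) -> (M -> 'rV[R]_m) -> M -> 'rV[R]_m)
    (X : M -> 'rV[R]_k) (Y : M -> 'rV[R]_m) (p : M) : 'rV[R]_m :=
  daddv_pi (transversal_bundle str ltr p) (tangent_bundle f p) (D X Y p).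

Definition phi_radical (R : realType) (k m : nat) (M : manifold R k)
    (N : manifold R m) (f : M -> N) (g : N -> bilinear_form R m)
    (phi : N -> 'End('rV[R]_m)) (p : M) : {vspace 'rV[R]_m} :=
  (phi (f p) @: radical f g p)%VS.

Record contact_CR_lightlike (R : realType) (k m : nat) (M : manifold R k)
    (N : manifold R m) (f : M -> N) (g : N -> bilinear_form R m)
    (phi : N -> 'End('rV[R]_m)) (nu : N -> 'rV[R]_m) (r : nat)
    (scr str ltr D0 D' L1 : M -> {vspace 'rV[R]_m}) : Prop := {
  cr_lightlike : lightlike_submanifold f g r scr str ltr;
  cr_nu_tangent : forall p, nu (f p) \in tangent_bundle f p;
  cr_radical_cap : forall p, (radical f g p :&: phi_radical f g phi p)%VS = 0%VS;
  cr_phi_radical_tangent : forall p,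
    (phi_radical f g phi p <= tangent_bundle f p)%VS;
  cr_phi_radical_bundle : subbundle f r (phi_radical f g phi);
  cr_D0_bundle : exists d, subbundle f d D0;
  cr_D'_bundle : exists d, subbundle f d D';
  cr_L1_bundle : exists d, subbundle f d L1;
  cr_screen_inner : forall p, (phi_radical f g phi p :&: D' p)%VS = 0%VS;
  cr_screen_mid : forall p,
    orth_direct_sum (g (f p)) (phi_radical f g phi p + D' p + D0 p)%VS
      (phi_radical f g phi p + D' p)%VS (D0 p);
  cr_screen : forall p,
    orth_direct_sum (g (f p)) (scr p)
      (phi_radical f g phi p + D' p + D0 p)%VS <[nu (f p)]>%VS;
  cr_D0_invariant : forall p, (phi (f p) @: D0 p)%VS = D0 p;
  cr_D0_nondegenerate : forall p, nondegenerate_on (g (f p)) (D0 p);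
  cr_L1_sub : forall p, (L1 p <= str p)%VS;
  cr_phi_D' : forall p,
    orth_direct_sum (g (f p)) (phi (f p) @: D' p)%VS (L1 p) (ltr p)
}.

(* D + {nu}, with D = Rad(TM) + phi(Rad(TM)) + D0 *)
Definition D_nu (R : realType) (k m : nat) (M : manifold R k)
    (N : manifold R m) (f : M -> N) (g : N -> bilinear_form R m)
    (phi : N -> 'End('rV[R]_m)) (nu : N -> 'rV[R]_m)
    (D0 : M -> {vspace 'rV[R]_m}) (p : M) : {vspace 'rV[R]_m} :=
  (radical f g p + phi_radical f g phi p + D0 p + <[nu (f p)]>)%VS.

(* The vector field phi(f_* X) along f. *)
Definition phi_push (R : realType) (k m : nat) (M : manifold R k)
    (N : manifold R m) (f : M -> N) (phi : N -> 'End('rV[R]_m))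
    (X : M -> 'rV[R]_k) (p : M) : 'rV[R]_m :=
  phi (f p) (tmap f p (X p)).

(* Main.v *)
Require Import Defs.
From HB Require Import structures.
From mathcomp Require Import all_boot all_order all_algebra.
From mathcomp Require Import all_classical all_reals all_analysis.
From mathcomp Require Import ring.
Import Order.TTheory GRing.Theory Num.Theory.
Import numFieldNormedType.Exports.
Set Implicit Arguments.
Unset Strict Implicit.
Unset Printing Implicit Defensive.
Local Open Scope classical_set_scope.
Local Open Scope ring_scope.

(** Write nabla' and h' for the dual objects nabla^* and h^*, and put
    L = nabla + nabla', twice the Levi-Civita connection, and write phi Y
    for phi(f_* Y).  Since h + h' is the transversal part of L, everything
    rests on one identity for sections X, Y of D + {nu}:

      (h + h')(X, phi Y) - (h + h')(Y, phi X)
        = 2 pi(phi(f_*[X, Y])),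

    where pi is the projection onto tr(TM) along TM.  It holds because
    L_X (phi Y) = phi(L_X Y) + 2 (eta(Y) phi X - g(phi X, Y) nu)
    ([phi_along]) and L_X Y - L_Y X = 2 [X, Y] ([torsion_along]); the
    correction terms are tangent to M, as phi maps D + {nu} into TM, so that pi
    kills them.  Finally phi maps the factor D' of TM = D + D' + {nu} into
    tr(TM) and the kernel of phi is spanned by nu, hence for w tangent to M the
    vector pi(phi w) vanishes exactly when w lies in D + {nu}
    ([proj_phi_eq0]).

    Both differential identities concern connections along f, which are known
    only on global vector fields of the ambient manifold N; the main work is to
    transport them from N to M.  The tool is tensoriality ([tensorial_cutfield]):
    an operator on sections along f that is additive, and linear over functions
    at the point p, takes the same value on a section s and on V o f, where V is
    any cutoff of the vector field with constant components s(p) in a chart.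
    The difference of the two sides of the first identity is such an operator,
    and on V o f the identity is the Kenmotsu condition.  For the second one,
    the operator is D_X s minus the derivative of the components of s; it
    reduces the claim to the torsion of nabla on the fields V, which commute at
    f(p), and to the symmetry of the second derivatives of f in charts
    ([schwarz]).  That nabla' is torsion-free as well follows from the
    Codazzi equation ([dual_torsion_free]).

    Cutoff functions come from exp(-1/t) ([is_derive_flat], [bump_row],
    [cutoff_exists]). *)

(** * Smooth functions on open sets of normed spaces *)

Section calc.
Context {R : realType}.
Implicit Types V W : normedModType R.

(** The difference of the two functions vanishes near x, hence has the zero map
    as differential there. *)
Lemma near_eq_differentiable V W (f g : V -> W) (x : V) :
  (\near x, f x = g x) -> differentiable f x -> differentiable g x.
Proof.
move=> fg df.
suff dh : differentiable (g - f) x.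
  have -> : g = (g - f) + f by rewrite subrK.
  exact: differentiableD.
have hx : \forall y \near x, (g - f) y = 0.
  near=> y; rewrite !fctE; apply/eqP; rewrite subr_eq0; apply/eqP.
  by symmetry; near: y.
move: (g - f) hx => h hx.
have key : h \o shift x = cst (h x) + (0 : V -> W) +o_ 0 id.
  apply/eqaddoP => e e0 /=.
  have := hx; rewrite (near_shift 0) => hx0.
  near=> y; rewrite !fctE /= (nbhs_singleton hx).
  have -> : h (y + x) = 0.
    rewrite -[x in y + x](subr0 x).
    by near: y; apply: hx0.
  by rewrite !(addr0, subr0, normr0) mulr_ge0 // ltW.
have d0 : 'd h x = (\0 : {linear V -> W}) :> (V -> W).
  by apply: diff_unique => // y; exact: cst_continuous.
apply/diff_locallyP; rewrite d0; split => // y; exact: cst_continuous.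
Unshelve. all: by end_near. Qed.

(** Scaling is a continuous bilinear map, so this is the chain rule for
    bilinear maps. *)
Lemma is_diff_scale V W (a : V -> R^o) (F : V -> W) x :
  differentiable a x -> differentiable F x ->
  is_diff x (fun y => a y *: F y)
    (fun v => a x *: 'd F x v + 'd a x v *: F x).
Proof.
move=> da dF.
have bil : bilinear_for (GRing.Scale.Law.clone _ _ *:%R _)
    (GRing.Scale.Law.clone _ _ *:%R _) (fun (k : R^o) (w : W) => k *: w).
  split=> [w|k] c x1 x2 /=; first by rewrite scalerDl scalerA.
  by rewrite scalerDr !scalerA mulrC.
pose m := bilinear_isBilinear.Build R R^o W W _ _ _ bil.
pose B : {bilinear R^o -> W -> W} := HB.pack (fun (k : R^o) (w : W) => k *: w) m.
have Bc : continuous (fun p : R^o * W => B p.1 p.2) by exact: scale_continuous.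
have Bd (p : R^o * W) : differentiable (fun p : R^o * W => p.1 *: p.2) p.
  exact: (differentiable_bilin p Bc).
have -> : (fun y => a y *: F y) = (fun p : R^o * W => p.1 *: p.2) \o (fun y => (a y, F y)) by [].
have dp : differentiable (fun y => (a y, F y)) x by exact: differentiable_pair.
apply: DiffDef; first exact: differentiable_comp.
rewrite diff_comp // diff_pair //.
by rewrite (diff_bilin (a x, F x) Bc).
Qed.

Lemma differentiable_scale V W (a : V -> R^o) (F : V -> W) x :
  differentiable a x -> differentiable F x ->
  differentiable (fun y => a y *: F y) x.
Proof. by move=> da dF; have [] := is_diff_scale da dF. Qed.

Lemma derive_scale V W (a : V -> R^o) (F : V -> W) x v :
  differentiable a x -> differentiable F x ->
  'D_v (fun y => a y *: F y) x = a x *: 'D_v F x + 'D_v a x *: F x.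
Proof.
move=> da dF; have [d e] := is_diff_scale da dF.
by rewrite !deriveE // e.
Qed.

Lemma diff_row n W (F : 'rV[R]_n -> W) x (v : 'rV[R]_n) :
  differentiable F x ->
  'd F x v = \sum_i v 0 i *: 'D_(delta_mx 0 i) F x.
Proof.
move=> dF; rewrite [in LHS](row_sum_delta v) linear_sum.
by apply: eq_bigr => i _; rewrite linearZ deriveE.
Qed.

Lemma derive_comp_row n V W (G : V -> 'rV[R]_n) (F : 'rV[R]_n -> W) x v :
  differentiable G x -> differentiable F (G x) ->
  'D_v (F \o G) x = \sum_i ('D_v G x) 0 i *: 'D_(delta_mx 0 i) F (G x).
Proof.
move=> dG dF; rewrite deriveE; last exact: differentiable_comp.
by rewrite diff_comp //= diff_row // deriveE.
Qed.

(** Smoothness with a bound n on the order of differentiation: closure of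
    [smooth_on] under products and compositions needs an induction on the order,
    because the derivative of such an expression is a sum of expressions of the
    same kind. *)
Fixpoint smooth_upto (n : nat) V W (A : set V) (F : V -> W) : Prop :=
  (forall x, A x -> differentiable F x) /\
  (if n is n'.+1 then forall v, smooth_upto n' A (fun x => 'D_v F x) else True).

Lemma smooth_onP V W (A : set V) (F : V -> W) :
  smooth_on A F <-> forall n, smooth_upto n A F.
Proof.
split.
  move=> sF n; elim: n F sF => [|n IH] F sF.
    by split => // x Ax; exact: (sF [::] x Ax).
  split; first by move=> x Ax; exact: (sF [::] x Ax).
  by move=> v; apply: IH => vs x Ax; exact: (sF (v :: vs) x Ax).
move=> sF vs; elim: vs F sF => [|v vs IH] F sF x Ax.
  by have [/(_ x Ax)] := sF 0%N.
by apply: (IH (fun x => 'D_v F x)) => // n; have [_ /(_ v)] := sF n.+1.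
Qed.

Lemma near_open V (A : set V) x : open A -> A x -> \forall y \near x, A y.
Proof. by move=> oA Ax; move: oA; rewrite openE => /(_ _ Ax). Qed.

(** Openness of A matters here: only then do functions that agree on A have the
    same derivatives on A. *)
Lemma smooth_upto_eq n V W (A : set V) (F G : V -> W) : open A ->
  (forall x, A x -> F x = G x) -> smooth_upto n A F -> smooth_upto n A G.
Proof.
move=> oA; elim: n F G => [|n IH] F G FG [dF sF].
  split=> // x Ax; apply: near_eq_differentiable (dF x Ax).
  by near=> y; apply: FG; near: y; exact: near_open.
split.
  move=> x Ax; apply: near_eq_differentiable (dF x Ax).
  by near=> y; apply: FG; near: y; exact: near_open.
move=> v; apply: IH (sF v) => x Ax; apply: near_eq_derive.
by near=> y; apply: FG; near: y; exact: near_open.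
Unshelve. all: by end_near. Qed.

Lemma smooth_uptoW n V W (A : set V) (F : V -> W) :
  smooth_upto n.+1 A F -> smooth_upto n A F.
Proof. by elim: n F => [|n IH] F [dF sF]; split => // v; apply: IH. Qed.

Lemma smooth_uptoD n V W (A : set V) (F G : V -> W) : open A ->
  smooth_upto n A F -> smooth_upto n A G -> smooth_upto n A (fun x => F x + G x).
Proof.
move=> oA; elim: n F G => [|n IH] F G [dF sF] [dG sG].
  by split=> // x Ax; apply: differentiableD; auto.
split=> [x Ax|v]; first by apply: differentiableD; auto.
apply: (smooth_upto_eq oA _ (IH _ _ (sF v) (sG v))) => x Ax.
by rewrite -deriveD //; apply: diff_derivable; auto.
Qed.

Lemma smooth_upto_cst n V W (A : set V) (w : W) : smooth_upto n A (fun=> w).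
Proof.
elim: n w => [|n IH] w; first by split=> // x _; exact: differentiable_cst.
split=> [x _|v]; first exact: differentiable_cst.
have -> : (fun x : V => 'D_v (fun=> w) x) = (fun=> 0).
  by apply/funext => x; exact: derive_cst.
exact: IH.
Qed.

Lemma smooth_upto_scale n V W (A : set V) (a : V -> R^o) (F : V -> W) : open A ->
  smooth_upto n A a -> smooth_upto n A F -> smooth_upto n A (fun x => a x *: F x).
Proof.
move=> oA; elim: n a F => [|n IH] a F [da sa] [dF sF].
  by split=> // x Ax; apply: differentiable_scale; auto.
split=> [x Ax|v]; first by apply: differentiable_scale; auto.
have saF : smooth_upto n A (fun x => a x *: 'D_v F x + 'D_v a x *: F x).
  have aW : smooth_upto n A a by apply: smooth_uptoW; split.
  have FW : smooth_upto n A F by apply: smooth_uptoW; split.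
  apply: smooth_uptoD => //; first exact: (IH _ _ aW (sF v)).
  exact: (IH _ _ (sa v) FW).
by apply: (smooth_upto_eq oA _ saF) => x Ax; rewrite derive_scale; auto.
Qed.

Lemma smooth_upto_linear n V W W' (A : set V) (L : {linear W -> W'}) (F : V -> W) :
  open A -> continuous L ->
  smooth_upto n A F -> smooth_upto n A (fun x => L (F x)).
Proof.
move=> oA cL; have dL w : differentiable L w by exact: linear_differentiable.
elim: n F => [|n IH] F [dF sF].
  by split=> // x Ax; apply: (@differentiable_comp _ _ _ _ F L); auto.
split=> [x Ax|v]; first by apply: (@differentiable_comp _ _ _ _ F L); auto.
apply: (smooth_upto_eq oA _ (IH _ (sF v))) => x Ax.
rewrite deriveE; last by auto.
rewrite deriveE; last by apply: (@differentiable_comp _ _ _ _ F L); auto.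
by rewrite (@diff_comp _ _ _ _ F L) /=; auto; rewrite diff_lin.
Qed.

Lemma smooth_upto_sum n V W (I : Type) (r : seq I) (A : set V) (F : I -> V -> W) :
  open A -> (forall i, smooth_upto n A (F i)) ->
  smooth_upto n A (fun x => \sum_(i <- r) F i x).
Proof.
move=> oA sF; elim: r => [|i r IH].
  by apply: (smooth_upto_eq oA _ (@smooth_upto_cst n V W A 0)) => x _; rewrite big_nil.
apply: (smooth_upto_eq oA _ (smooth_uptoD oA (sF i) IH)) => x _.
by rewrite big_cons.
Qed.

Lemma coord_continuousE n (i : 'I_n) : continuous (fun x : 'rV[R]_n => x 0 i : R^o).
Proof. exact: coord_continuous. Qed.

Lemma smooth_upto_coord n V m (A : set V) (F : V -> 'rV[R]_m) i : open A ->
  smooth_upto n A F -> smooth_upto n A (fun x => F x 0 i : R^o).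
Proof.
move=> oA sF.
have lin : linear (fun x : 'rV[R]_m => x 0 i : R^o) by move=> a x y; rewrite !mxE.
pose L : {linear 'rV[R]_m -> R^o} := HB.pack (fun x : 'rV[R]_m => x 0 i : R^o)
  (GRing.isLinear.Build _ _ _ _ _ lin).
have cL : continuous L by exact: coord_continuousE.
exact: (@smooth_upto_linear _ V _ _ A L F oA cL sF).
Qed.

(** By [derive_comp_row], the derivative of F o G is a combination of composites
    of G with derivatives of F, to which the induction hypothesis applies. *)
Lemma smooth_upto_comp n V m W (A : set V) (B : set 'rV[R]_m)
    (G : V -> 'rV[R]_m) (F : 'rV[R]_m -> W) : open A ->
  (forall x, A x -> B (G x)) ->
  smooth_upto n A G -> smooth_upto n B F -> smooth_upto n A (F \o G).
Proof.
move=> oA AB; elim: n F => [|n IH] F [dG sG] [dF sF].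
  by split=> // x Ax; apply: differentiable_comp; auto.
split=> [x Ax|v]; first by apply: differentiable_comp; auto.
have s1 : smooth_upto n A
    (fun x => \sum_i ('D_v G x) 0 i *: 'D_(delta_mx 0 i) F (G x)).
  apply: smooth_upto_sum => // i; apply: smooth_upto_scale => //.
    by apply: smooth_upto_coord => //; exact: (sG v).
  apply: (IH (fun y => 'D_(delta_mx 0 i) F y)); last exact: sF.
  by apply: smooth_uptoW; split.
by apply: (smooth_upto_eq oA _ s1) => x Ax; rewrite derive_comp_row; auto.
Qed.

End calc.

(** * The flat function exp(-1/t) *)

Section flat.
Context {R : realType}.

(** The polynomial factor makes the family stable under derivation, which gives
    smoothness of all its members at once; the case p = 1 is the function of
    interest. *)
Definition flat (p : {poly R}) (t : R) : R :=
  if 0 < t then p.[t^-1] * expR (- t^-1) else 0.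

Lemma exprn_le_expR n (x : R) : 0 <= x -> x ^+ n <= n%:R ^+ n * expR x.
Proof.
move=> x0; case: n => [|n]; first by rewrite !expr0 mul1r -expR0 ler_expR.
have n0 : 0 < n.+1%:R :> R by rewrite ltr0n.
have -> : expR x = expR (x / n.+1%:R) ^+ n.+1.
  by rewrite -expRM_natl mulrC divfK // gt_eqF.
have xle : x <= n.+1%:R * expR (x / n.+1%:R).
  rewrite -ler_pdivrMl // mulrC.
  by apply: le_trans (expR_ge1Dx _); rewrite lerDr.
by rewrite -exprMn; apply: lerXn2r => //; rewrite nnegrE mulr_ge0 ?expR_ge0 // ltW.
Qed.

(** The growth bound behind the flatness of exp(-1/t) at 0. *)
Lemma poly_le_expR (p : {poly R}) :
  exists2 C, 0 < C & forall x, 0 <= x -> `|p.[x]| <= C * expR x.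
Proof.
exists (1 + \sum_(i < size p) `|p`_i| * i%:R ^+ i).
  by rewrite ltr_pwDl // sumr_ge0 // => i _; rewrite mulr_ge0 // exprn_ge0.
move=> x x0; rewrite horner_coef mulrDl mul1r mulr_suml.
apply: le_trans (ler_norm_sum _ _ _) _.
apply: ler_wpDl; first exact: expR_ge0.
apply: ler_sum => i _; rewrite normrM normrX (ger0_norm x0) -mulrA.
by apply: ler_wpM2l => //; exact: exprn_le_expR.
Qed.

(** At t = 0 the estimate |flat p h| <= C h^2 gives a zero derivative. *)
Lemma is_derive_flat (p : {poly R}) (t : R) :
  is_derive t 1 (flat p) (flat ((p - p^`()) * 'X^2) t).
Proof.
have [t0|t0|t0] := ltgtP t 0.
- have -> : flat ((p - p^`()) * 'X^2) t = 0 by rewrite /flat ltNge (ltW t0).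
  have E : \forall s \near t, cst 0 s = flat p s.
    near=> s; rewrite /flat ltNge ltW //.
    by near: s; exact: lt_nbhsl.
  exact: near_eq_is_derive E (is_derive_cst _ _ _).
- have tn : t != 0 by rewrite gt_eqF.
  have -> : flat ((p - p^`()) * 'X^2) t = ((p - p^`()) * 'X^2).[t^-1] * expR (- t^-1).
    by rewrite /flat t0.
  pose u : R -> R := fun s => s^-1.
  have du : is_derive t 1 u (- t^-2).
    have := @is_deriveV R id t 1 1 tn (is_derive_id _ _).
    by rewrite /u; move/is_derive_eq; apply; rewrite scaler1.
  have d1 := @is_derive1_comp _ (horner p) u t _ _ (is_derive_poly p (u t)) du.
  have d2 : is_derive t 1 (expR \o (- u)) (expR (- u t) * (- - t^-2)).
    exact: (@is_derive1_comp _ expR (- u) t _ _ (is_derive_expR _) (is_deriveN du)).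
  have d3 := is_deriveM d1 d2.
  have E : \forall s \near t, ((horner p \o u) * (expR \o (- u))) s = flat p s.
    near=> s; rewrite /flat.
    have -> : 0 < s by near: s; exact: lt_nbhsr.
    by [].
  apply: near_eq_is_derive E _.
  apply: is_derive_eq d3 _.
  rewrite !hornerE /u /= !opprK /GRing.scale /= !fctE; field; exact: tn.
- rewrite t0; have -> : flat ((p - p^`()) * 'X^2) 0 = 0 by rewrite /flat ltxx.
  have [C C0 HC] := poly_le_expR (p * 'X^2).
  have key (h : R) : `|flat p h| <= C * h ^+ 2.
    rewrite /flat; case: ifPn => h0; last by rewrite normr0 mulr_ge0 ?sqr_ge0 // ltW.
    have hn : h != 0 by rewrite gt_eqF.
    rewrite normrM (ger0_norm (expR_ge0 _)) expRN ler_pdivrMr ?expR_gt0 //.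
    rewrite mulrAC -ler_pdivrMr ?exprn_gt0 // -exprVn.
    apply: le_trans (HC h^-1 _); last by rewrite invr_ge0 ltW.
    by rewrite hornerM hornerXn normrM [X in _ <= _ * X]ger0_norm // exprn_ge0 // invr_ge0 ltW.
  have cv : h^-1 *: ((flat p \o shift 0) (h *: 1) - flat p 0) @[h --> 0^'] --> (0 : R).
    apply/cvgrPdist_le => e e0.
    near=> h.
    have hn : h != 0 by near: h; exact: nbhs_dnbhs_neq.
    rewrite sub0r normrN /= addr0 /GRing.scale /= mulr1 {2}/flat ltxx subr0.
    rewrite normrM normfV ler_pdivrMl ?normr_gt0 //.
    apply: le_trans (key h) _.
    rewrite -real_normK ?num_real // expr2 mulrCA ler_wpM2l //.
    rewrite -ler_pdivlMl //.
    near: h; apply: dnbhs0_le; by rewrite mulr_gt0 // invr_gt0.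
  apply: DeriveDef; last exact: (cvg_lim _ cv).
  by apply/cvg_ex; exists 0.
Unshelve. all: by end_near. Qed.

Lemma flat_ge0 (t : R) : 0 <= flat 1 t.
Proof. by rewrite /flat; case: ifP => // _; rewrite hornerC mul1r expR_ge0. Qed.
Lemma flat_gt0 (t : R) : 0 < t -> 0 < flat 1 t.
Proof. by rewrite /flat => ->; rewrite hornerC mul1r expR_gt0. Qed.
Lemma flat_le0 (t : R) : t <= 0 -> flat 1 t = 0.
Proof. by rewrite /flat ltNge => ->. Qed.

(** By [derive_comp_row], the derivative of F o G is a combination of composites
    of G with derivatives of F, to which the induction hypothesis applies. *)
(** Composing with a real function e is a one-dimensional chain rule; to iterate
    it, the derivative of e has to stay in a class P of functions with the same
    property, such as the flat functions or the multiples of powers of 1/t. *)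
Lemma smooth_upto_comp_real (P : (R -> R) -> Prop) (B : set R) n
   (V : normedModType R) (A : set V) (a : V -> R^o) (e : R -> R) :
  (forall e, P e -> exists2 e', P e' & forall t, B t -> is_derive t 1 e (e' t)) ->
  P e -> open A -> (forall x, A x -> B (a x)) -> smooth_upto n A a ->
  smooth_upto n A (fun x => e (a x) : R^o).
Proof.
move=> HP Pe oA AB; elim: n e Pe => [|n IH] e Pe [da sa];
  have [e' Pe' de] := HP _ Pe.
  have de1 x : A x -> differentiable (e : R^o -> R^o) (a x).
    by move=> Ax; apply/derivable1_diffP; have [] := de _ (AB _ Ax).
  by split=> // x Ax; apply: (differentiable_comp (da x Ax) (de1 x Ax)).
have de1 x : A x -> differentiable (e : R^o -> R^o) (a x).
  by move=> Ax; apply/derivable1_diffP; have [] := de _ (AB _ Ax).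
split=> [x Ax|v]; first by apply: (differentiable_comp (da x Ax) (de1 x Ax)).
have s1 : smooth_upto n A (fun x => (e' (a x) : R^o) *: ('D_v a x : R^o)).
  apply: smooth_upto_scale => //.
    by apply: IH => //; apply: smooth_uptoW; split.
  exact: sa.
apply: (smooth_upto_eq oA _ s1) => x Ax.
have dc := differentiable_comp (da x Ax) (de1 x Ax).
rewrite [RHS](deriveE _ dc) (diff_comp (da x Ax) (de1 x Ax)) /=.
rewrite -(@deriveE _ _ _ a x v (da x Ax)); set w := 'D_v a x.
have -> : w = w *: (1 : R^o) by rewrite /GRing.scale /= mulr1.
rewrite [RHS]linearZ /= -(@deriveE _ _ _ (e : R^o -> R^o) _ _ (de1 x Ax)).
have [_ ->] := de _ (AB _ Ax).
by rewrite /GRing.scale /= mulr1 mulrC.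
Qed.

End flat.

(** * Bump functions on coordinate spaces *)

Section bump.
Context {R : realType}.

Lemma flat_stable (e : R -> R) : (exists p, e = flat p) ->
  exists2 e' : R -> R, (exists p, e' = flat p) & forall t : R, setT t -> is_derive t 1 e (e' t).
Proof.
move=> [p ->]; exists (flat ((p - p^`()) * 'X^2)); first by eexists.
by move=> t _; exact: is_derive_flat.
Qed.

Lemma inv_stable (e : R -> R) : (exists c n, e = fun t => c * t^-1 ^+ n) ->
  exists2 e' : R -> R, (exists c n, e' = fun t => c * t^-1 ^+ n) &
    forall t : R, [set t : R | t != 0] t -> is_derive t 1 e (e' t).
Proof.
move=> [c [n ->]]; exists (fun t => (- (c * n%:R)) * t^-1 ^+ n.+1); first by do 2 eexists.
move=> t /= tn.
have du : is_derive t 1 (fun s : R => s^-1) (- t^-2).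
  have := @is_deriveV R id t 1 1 tn (is_derive_id _ _).
  by move/is_derive_eq; apply; rewrite scaler1.
have dX : is_derive (t^-1) 1 (fun x : R => x ^+ n) (n%:R * t^-1 ^+ n.-1).
  have -> : (fun x : R => x ^+ n) = id ^+ n by apply/funext => x; rewrite exprfctE.
  apply: is_derive_eq (is_deriveX n (is_derive_id _ _)) _.
  by rewrite /GRing.scale /= mulr1.
have d1 := @is_derive1_comp _ (fun x : R => x ^+ n) (fun s : R => s^-1) t _ _ dX du.
have d2 := is_deriveZ c d1.
apply: (is_derive_eq d2).
rewrite /GRing.scale /=; case: n {dX d1 d2} => [|n]; rewrite ?mulr0n /=.
  by rewrite !(mul0r, mulr0, oppr0).
rewrite !exprS expr0 mulr1 invfM; ring.
Qed.

Definition sqnorm m (x : 'rV[R]_m) : R^o := \sum_i x 0 i ^+ 2.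

Lemma smooth_upto_sqnorm n m (a : 'rV[R]_m) :
  smooth_upto n setT (fun x : 'rV[R]_m => sqnorm (x - a)).
Proof.
have si i : smooth_upto n setT (fun x : 'rV[R]_m => x 0 i - a 0 i : R^o).
  apply: smooth_uptoD => //; first exact: openT.
    apply: (@smooth_upto_coord R n 'rV[R]_m m setT id i openT).
    elim: n => [|n IH]; split => // v.
    have -> : (fun x : 'rV[R]_m => 'D_v id x) = (fun=> v).
      by apply/funext => x; rewrite derive_id.
    exact: smooth_upto_cst.
  exact: smooth_upto_cst.
have s1 : smooth_upto n setT (fun x : 'rV[R]_m =>
    \sum_i (x 0 i - a 0 i : R^o) *: (x 0 i - a 0 i : R^o) : R^o).
  apply: smooth_upto_sum => [|i]; first exact: openT.
  by apply: smooth_upto_scale => //; exact: openT.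
apply: (smooth_upto_eq openT _ s1) => x _.
by apply: eq_bigr => i _; rewrite !mxE expr2.
Qed.

Lemma sqnorm_continuous m (a : 'rV[R]_m) : continuous (fun x : 'rV[R]_m => sqnorm (x - a)).
Proof.
move=> x; apply: differentiable_continuous.
by have [+ _] := @smooth_upto_sqnorm 0 m a; apply.
Qed.

(** With Q the squared distance to a and E = exp(-1/t), extended by 0 to t <= 0,
    the quotient E(2c - Q) / (E(2c - Q) + E(Q - c)) equals 1 where Q <= c and 0
    where Q >= 2c; its denominator never vanishes, since Q < 2c or Q > c. *)
Lemma bump_row m (a : 'rV[R]_m) (O : set 'rV[R]_m) : open O -> O a ->
  exists (b : 'rV[R]_m -> R^o) (K : set 'rV[R]_m),
   [/\ smooth_on setT b, \forall x \near a, b x = 1,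
       compact K, K `<=` O & forall x, ~ K x -> b x = 0].
Proof.
move=> oO Oa.
have /nbhs_ballP[e /= e0 eO] : nbhs a O by exact: open_nbhs_nbhs.
(* 2c = (e/2)^2, so that Q < 2c keeps every coordinate within e/2 of a. *)
pose c : R := (e / 2) ^+ 2 / 2.
have c0 : 0 < c by rewrite divr_gt0 // exprn_gt0 // divr_gt0.
pose Q := fun x : 'rV[R]_m => sqnorm (x - a).
pose u x := flat 1 (2 * c - Q x).
pose d x := flat 1 (2 * c - Q x) + flat 1 (Q x - c).
have d0 x : 0 < d x.
  rewrite /d; have [h|h] := ltP (Q x) (2 * c).
    by rewrite ltr_pwDl ?flat_ge0 // flat_gt0 // subr_gt0.
  rewrite ltr_wpDl ?flat_ge0 // flat_gt0 // subr_gt0.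
  by apply: lt_le_trans h; rewrite ltr_pMl // ltr1n.
have sQ n : smooth_upto n setT (Q : _ -> R^o) by exact: smooth_upto_sqnorm.
have sQN n : smooth_upto n setT (fun x => - Q x : R^o).
  have s1 : smooth_upto n setT (fun x => (-1 : R^o) *: (Q x : R^o) : R^o).
    by apply: smooth_upto_scale => //; [exact: openT|exact: smooth_upto_cst].
  apply: (smooth_upto_eq openT _ s1) => x _.
  by rewrite /GRing.scale /= mulN1r.
have sF n (g : 'rV[R]_m -> R^o) : smooth_upto n setT g -> smooth_upto n setT (fun x => flat 1 (g x) : R^o).
  move=> sg; apply: (smooth_upto_comp_real flat_stable) sg => //; last exact: openT.
  by exists 1.
have su n : smooth_upto n setT (u : _ -> R^o).
  by apply: sF; apply: smooth_uptoD => //; [exact: openT|exact: smooth_upto_cst].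
have sd n : smooth_upto n setT (d : _ -> R^o).
  apply: smooth_uptoD => //; first exact: openT.
  by apply: sF; apply: smooth_uptoD => //; [exact: openT|exact: smooth_upto_cst].
have sb : smooth_on setT (fun x => (u x : R^o) *: ((d x)^-1 : R^o)).
  apply/smooth_onP => n; apply: smooth_upto_scale => //; first exact: openT.
  have s1 : smooth_upto n setT (fun x => 1 * (d x)^-1 ^+ 1 : R^o).
    apply: (smooth_upto_comp_real (e := fun t => 1 * t^-1 ^+ 1) inv_stable) (sd n) => //.
    - by exists 1, 1%N.
    - exact: openT.
    - by move=> x _ /=; rewrite gt_eqF.
  by apply: (smooth_upto_eq openT _ s1) => x _; rewrite mul1r expr1.
exists (fun x => (u x : R^o) *: ((d x)^-1 : R^o)).
exists [set x | forall i, x 0 i \in `[a 0 i - e / 2, a 0 i + e / 2]].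
split=> //.
- have Qa : Q a < c by rewrite /Q subrr /sqnorm big1 // => i _; rewrite mxE expr0n.
  near=> x.
  have Qx : Q x < c.
    near: x; have /= cQ := @sqnorm_continuous m a a.
    exact: (cvgr_lt _ cQ _ Qa).
  rewrite /GRing.scale /= /u /d [flat 1 (Q x - c)]flat_le0 ?addr0; last by rewrite subr_le0 ltW.
  rewrite divff // gt_eqF // flat_gt0 // subr_gt0.
  by apply: lt_le_trans Qx _; rewrite ler_pMl // ler1n.
- apply: (rV_compact (A := fun i => `[a 0 i - e / 2, a 0 i + e / 2]%classic)) => i.
  exact: segment_compact.
- move=> x /= xK; apply: eO; rewrite -ball_normE /= [ltLHS]/Num.Def.normr /= mx_normrE.
  apply: (@le_lt_trans _ _ (e / 2)); last by rewrite ltr_pdivrMr // ltr_pMr // ltr1n.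
  apply: bigmax_le => [|[i j] _]; first by rewrite ltW // divr_gt0.
  rewrite !mxE /= (ord1 i); have := xK j; rewrite in_itv /= => /andP[h1 h2].
  by rewrite distrC ler_distl; apply/andP; split.
- move=> x /= xK; rewrite /GRing.scale /= /u flat_le0 ?mul0r // subr_le0 leNgt; apply/negP => h.
  apply: xK => i; rewrite in_itv /= -ler_distl.
  rewrite -(@ler_pXn2r _ 2) // ?nnegrE ?normr_ge0 //; last by rewrite ltW // divr_gt0.
  rewrite real_normK ?num_real //.
  apply: le_trans (_ : Q x <= _); last by rewrite ltW // (lt_le_trans h) // /c mulrC divfK.
  rewrite /Q /sqnorm (bigD1 i) //= !mxE lerDl sumr_ge0 // => j _; exact: sqr_ge0.
Unshelve. all: by end_near. Qed.

End bump.

(** * Symmetry of second derivatives *)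

Section schwarz.
Context {R : realType}.
Variable V : normedModType R.

Lemma is_derive_line (F : V -> R^o) (z u : V) (s : R) :
  differentiable F (z + s *: u) ->
  is_derive s 1 (fun s : R => F (z + s *: u) : R) ('D_u F (z + s *: u)).
Proof.
move=> dF.
have dl : is_diff s (fun s : R^o => z + s *: u) (fun s : R^o => s *: u).
  apply: is_diff_eq; rewrite funeqE => t /=.
  by rewrite !fctE add0r.
have dc : differentiable (F \o (fun s : R^o => z + s *: u)) s.
  by apply: differentiable_comp.
have := diff_derivable (v := (1 : R^o)) dc; move/derivableP => h.
apply: is_derive_eq h _.
rewrite deriveE // diff_comp //= diff_val scale1r deriveE //.
Qed.

Lemma MVT_line (F : V -> R^o) (z u : V) (t : R) : 0 < t ->
  (forall s, 0 <= s <= t -> differentiable F (z + s *: u)) ->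
  exists2 s, 0 <= s <= t & F (z + t *: u) - F z = t * 'D_u F (z + s *: u).
Proof.
move=> t0 dF.
have d1 s : s \in `]0, t[ -> is_derive s 1 (fun s => F (z + s *: u) : R) ('D_u F (z + s *: u)).
  rewrite in_itv /= => /andP[s0 st]; apply: is_derive_line.
  by apply: dF; rewrite !ltW.
have c1 : {within `[0, t], continuous (fun s => F (z + s *: u) : R)}.
  apply: derivable_within_continuous => s; rewrite in_itv /= => st.
  by have [] := is_derive_line (dF s st).
have [s] := MVT t0 d1 c1.
rewrite in_itv /= => /andP[s0 st] e; exists s; first by rewrite !ltW.
by rewrite subr0 scale0r addr0 mulrC in e; rewrite e.
Qed.

(** The second difference of F on a parallelogram with sides t u and t v is
    t^2 times a value of D_v D_u F, and by symmetry t^2 times a value of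
    D_u D_v F, at points that tend to x with t; both second derivatives are
    continuous. *)
Lemma schwarz_scalar (A : set V) (F : V -> R^o) (x u v : V) : open A -> A x ->
  smooth_on A F -> 'D_u (fun y => 'D_v F y) x = 'D_v (fun y => 'D_u F y) x.
Proof.
move=> oA Ax sF.
have dF y : A y -> differentiable F y := sF [::] y.
have dFu w y : A y -> differentiable (fun y => 'D_w F y) y := sF [:: w] y.
have cF w1 w2 y : A y -> {for y, continuous (fun y => 'D_w1 (fun y => 'D_w2 F y) y)}.
  by move=> Ay; apply: differentiable_continuous; exact: (sF [:: w2; w1] y Ay).
(* Two applications of the mean value theorem to the second difference. *)
have main (p q : V) (t : R) : 0 < t ->
  (forall s r, 0 <= s <= t -> 0 <= r <= t -> A (x + s *: p + r *: q)) ->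
  exists s r, [/\ 0 <= s <= t, 0 <= r <= t &
    F (x + t *: p + t *: q) - F (x + t *: p) - F (x + t *: q) + F x
    = t ^+ 2 * 'D_q (fun y => 'D_p F y) (x + s *: p + r *: q)].
  move=> t0 HA.
  have tt : 0 <= t <= t by apply/andP; split; [exact: ltW|].
  have t00 : 0 <= (0 : R) <= t by apply/andP; split; [|exact: ltW].
  have Ap s : 0 <= s <= t -> A (x + s *: p).
    by move=> hs; have := HA s 0 hs t00; rewrite scale0r addr0.
  pose G y := F (y + t *: q) - F y : R^o.
  have dsh y : A (y + t *: q) -> differentiable (fun y => F (y + t *: q)) y /\
      'D_p (fun y => F (y + t *: q)) y = 'D_p F (y + t *: q).
    move=> Ay; have d1 : is_diff y (fun y => y + t *: q) id.
      by apply: is_diff_eq; rewrite funeqE => z; rewrite !fctE /= addr0.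
    have d2 := dF _ Ay.
    have d3 := @is_diff_comp _ _ _ _ (fun y => y + t *: q) id F _ y d1 (differentiableP d2).
    have e3 : differentiable (fun y => F (y + t *: q)) y := ex_diff (is_diff_def := d3).
    split=> //; rewrite !deriveE //.
    by have [_ e4] := d3; rewrite [LHS](congr1 (@^~ p) e4).
  have dG s : 0 <= s <= t -> differentiable G (x + s *: p) /\
      'D_p G (x + s *: p) = 'D_p F (x + s *: p + t *: q) - 'D_p F (x + s *: p).
    move=> hs; have [h1 h2] := dsh _ (HA s t hs tt); have h3 := dF _ (Ap s hs).
    split; first exact: differentiableB.
    by rewrite -h2 -deriveB //; apply: diff_derivable.
  have [s hs Es] : exists2 s, 0 <= s <= t & G (x + t *: p) - G x = t * 'D_p G (x + s *: p).
    by apply: MVT_line => // s hs; have [] := dG s hs.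
  have [_ EG] := dG s hs.
  have [r hr Er] : exists2 r, 0 <= r <= t &
    'D_p F (x + s *: p + t *: q) - 'D_p F (x + s *: p)
    = t * 'D_q (fun y => 'D_p F y) (x + s *: p + r *: q).
    by apply: (MVT_line (F := fun y => 'D_p F y)) => // r hr; apply: dFu; exact: HA.
  exists s, r; split=> //.
  rewrite expr2 -mulrA -Er -EG -Es /G opprB -[LHS]addrA; congr (_ + _).
  exact: addrC.
have near_small (P : V -> Prop) : (\forall y \near x, P y) -> exists2 e : R, 0 < e &
   forall t s r p q, 0 < t -> t * (`|p| + `|q|) < e -> 0 <= s <= t -> 0 <= r <= t ->
     P (x + s *: p + r *: q).
  move=> /nbhs_ballP[e /= e0 eP]; exists e => // t s r p q t0 te /andP[s0 st] /andP[r0 rt].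
  apply: eP; rewrite -ball_normE /= -[x + _ + _]addrA opprD addNKr normrN.
  apply: le_lt_trans te; apply: le_trans (ler_normD _ _) _.
  rewrite !normrZ !ger0_norm // mulrDr lerD // ler_wpM2r //.
pose a y := 'D_u (fun y => 'D_v F y) y : R; pose b y := 'D_v (fun y => 'D_u F y) y : R.
apply/eqP; rewrite -subr_eq0 -normr_le0; apply/ler_addgt0Pr => e e0; rewrite add0r.
have e20 : 0 < e / 2 by rewrite divr_gt0.
have nP : \forall y \near x, [/\ A y, `|a x - a y| < e / 2 & `|b x - b y| < e / 2].
  have h1 : \forall y \near x, A y by exact: near_open.
  have h2 : \forall y \near x, `|a x - a y| < e / 2.
    have := cF u v x Ax; rewrite /continuous_at => h.
    by move/cvgrPdist_lt : h; apply.
  have h3 : \forall y \near x, `|b x - b y| < e / 2.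
    have := cF v u x Ax; rewrite /continuous_at => h.
    by move/cvgrPdist_lt : h; apply.
  by apply: filter_app h3; apply: filter_app h2; apply: filterS h1 => y *; split.
have [d d0 Hd] := near_small _ nP.
have [t t0 td] : exists2 t : R, 0 < t & t * (`|u| + `|v|) < d.
  have n0 : 0 < `|u| + `|v| + 1 by rewrite ltr_wpDl // addr_ge0.
  exists (d / (`|u| + `|v| + 1)); first exact: divr_gt0.
  by rewrite mulrAC ltr_pdivrMr // ltr_pM2l // ltrDl.
have [s [r [hs hr E1]]] := main u v t t0 (fun s r hs hr => let: And3 h _ _ := Hd t s r u v t0 td hs hr in h).
have td' : t * (`|v| + `|u|) < d by rewrite addrC.
have [s' [r' [hs' hr' E2]]] := main v u t t0 (fun s r hs hr => let: And3 h _ _ := Hd t s r v u t0 td' hs hr in h).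
have Eab : a (x + s' *: v + r' *: u) = b (x + s *: u + r *: v).
  have tn : t ^+ 2 != 0 by rewrite expf_neq0 // gt_eqF.
  suff h : t ^+ 2 * a (x + s' *: v + r' *: u) = t ^+ 2 * b (x + s *: u + r *: v).
    exact: (mulfI tn h).
  apply: etrans (esym E2) _; apply: etrans _ E1.
  by rewrite (addrAC x (t *: v)) (addrAC (F (x + t *: u + t *: v))).
have [_ ha _] := Hd t s' r' v u t0 td' hs' hr'.
have [_ _ hb] := Hd t s r u v t0 td hs hr.
rewrite -[X in X - _]/(a x) -[X in _ - X]/(b x).
rewrite (splitr e).
have -> : a x - b x = (a x - a (x + s' *: v + r' *: u)) + (b (x + s *: u + r *: v) - b x).
  by rewrite Eab subrKA.
apply: le_trans (ler_normD _ _) _; apply: lerD; first exact: (ltW ha).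
by rewrite distrC; exact: (ltW hb).
Unshelve. all: by end_near. Qed.
End schwarz.

(** * Calculus of smooth functions *)

Section smooth_on.
Context {R : realType}.
Implicit Types V W : normedModType R.

Lemma smooth_on_differentiable V W (A : set V) (F : V -> W) x :
  smooth_on A F -> A x -> differentiable F x.
Proof. by move=> sF Ax; exact: (sF [::] x Ax). Qed.

Lemma smooth_on_derive V W (A : set V) (F : V -> W) v :
  smooth_on A F -> smooth_on A (fun x => 'D_v F x).
Proof. by move=> sF vs; exact: (sF (v :: vs)). Qed.

Lemma smooth_onW V W (A B : set V) (F : V -> W) :
  B `<=` A -> smooth_on A F -> smooth_on B F.
Proof. by move=> BA sF vs x Bx; apply: sF; exact: BA. Qed.

Lemma smooth_on_local V W (A : set V) (F : V -> W) :
  (forall x, A x -> exists2 B, B x & smooth_on B F) -> smooth_on A F.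
Proof. by move=> H vs x /H[B Bx]; apply. Qed.

Lemma smooth_on_eq V W (A : set V) (F G : V -> W) : open A ->
  (forall x, A x -> F x = G x) -> smooth_on A F -> smooth_on A G.
Proof.
move=> oA FG /smooth_onP sF; apply/smooth_onP => n.
exact: smooth_upto_eq FG (sF n).
Qed.

Lemma smooth_onD V W (A : set V) (F G : V -> W) : open A ->
  smooth_on A F -> smooth_on A G -> smooth_on A (fun x => F x + G x).
Proof.
move=> oA /smooth_onP sF /smooth_onP sG; apply/smooth_onP => n.
exact: smooth_uptoD.
Qed.

Lemma smooth_on_cst V W (A : set V) (w : W) : smooth_on A (fun=> w).
Proof. by apply/smooth_onP => n; exact: smooth_upto_cst. Qed.

Lemma smooth_on_scale V W (A : set V) (a : V -> R^o) (F : V -> W) : open A ->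
  smooth_on A a -> smooth_on A F -> smooth_on A (fun x => a x *: F x).
Proof.
move=> oA /smooth_onP sa /smooth_onP sF; apply/smooth_onP => n.
exact: smooth_upto_scale.
Qed.

Lemma smooth_on_sum V W (I : Type) (r : seq I) (A : set V) (F : I -> V -> W) :
  open A -> (forall i, smooth_on A (F i)) ->
  smooth_on A (fun x => \sum_(i <- r) F i x).
Proof.
move=> oA sF; apply/smooth_onP => n; apply: smooth_upto_sum => // i.
by have /smooth_onP := sF i.
Qed.

Lemma smooth_on_coord V m (A : set V) (F : V -> 'rV[R]_m) i : open A ->
  smooth_on A F -> smooth_on A (fun x => F x 0 i : R^o).
Proof.
move=> oA /smooth_onP sF; apply/smooth_onP => n; exact: smooth_upto_coord.
Qed.

Lemma smooth_on_comp V m W (A : set V) (B : set 'rV[R]_m)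
    (G : V -> 'rV[R]_m) (F : 'rV[R]_m -> W) : open A ->
  (forall x, A x -> B (G x)) ->
  smooth_on A G -> smooth_on B F -> smooth_on A (F \o G).
Proof.
move=> oA AB /smooth_onP sG /smooth_onP sF; apply/smooth_onP => n.
exact: smooth_upto_comp AB (sG n) (sF n).
Qed.

Lemma smooth_on_diff V m W (A : set V) (B : set 'rV[R]_m)
    (G H : V -> 'rV[R]_m) (F : 'rV[R]_m -> W) : open A ->
  (forall x, A x -> B (G x)) ->
  smooth_on A G -> smooth_on A H -> smooth_on B F ->
  smooth_on A (fun x => 'd F (G x) (H x)).
Proof.
move=> oA AB sG sH sF.
have s1 : smooth_on A (fun x => \sum_i H x 0 i *: 'D_(delta_mx 0 i) F (G x)).
  apply: smooth_on_sum => // i; apply: smooth_on_scale => //.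
    exact: smooth_on_coord.
  exact: (smooth_on_comp oA AB sG (smooth_on_derive (delta_mx 0 i) sF)).
apply: (smooth_on_eq oA _ s1) => x Ax.
by rewrite diff_row //; apply: smooth_on_differentiable sF _; exact: AB.
Qed.

(** The product rule for dF_y(H y): differentiate H, or differentiate F with the
    vector H x frozen. *)
Lemma derive_diff m W (A : set 'rV[R]_m) (F : 'rV[R]_m -> W)
    (H : 'rV[R]_m -> 'rV[R]_m) x w : open A -> A x ->
  smooth_on A F -> differentiable H x ->
  'D_w (fun y => 'd F y (H y)) x
  = 'd F x ('D_w H x) + 'D_w (fun y => 'D_(H x) F y) x.
Proof.
move=> oA Ax sF dH.
have dF y : A y -> differentiable F y by move=> Ay; exact: (smooth_on_differentiable sF).
have dDF t y : A y -> differentiable (fun y => 'D_t F y) y.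
  by move=> Ay; exact: (smooth_on_differentiable (smooth_on_derive t sF)).
have dHi i : differentiable (fun y => H y 0 i : R^o) x.
  exact: (differentiable_comp dH (differentiable_coord (H x) 0 i)).
have DHi i : 'D_w (fun y => H y 0 i : R^o) x = ('D_w H x) 0 i.
  by rewrite derive_mx ?mxE //; exact: diff_derivable.
have nA := near_open oA Ax.
have -> : 'D_w (fun y => 'd F y (H y)) x
    = 'D_w (\sum_i (fun y => (H y 0 i : R^o) *: 'D_(delta_mx 0 i) F y)) x.
  apply: near_eq_derive; near=> y.
  rewrite fct_sumE diff_row //; apply: dF; near: y; exact: nA.
have -> : 'D_w (fun y => 'D_(H x) F y) x
    = 'D_w (\sum_i ((H x 0 i) *: (fun y => 'D_(delta_mx 0 i) F y))) x.
  apply: near_eq_derive; near=> y.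
  have Fy : differentiable F y by apply: dF; near: y; exact: nA.
  by rewrite fct_sumE deriveE // diff_row.
rewrite derive_sum => [|i]; last first.
  apply: diff_derivable; apply: differentiable_scale => //; exact: dDF.
rewrite derive_sum => [|i]; last first.
  apply: diff_derivable; apply: differentiableZ; exact: dDF.
rewrite diff_row; last exact: dF.
rewrite -big_split /=; apply: eq_bigr => i _.
rewrite derive_scale //; last exact: dDF.
rewrite DHi addrC; congr (_ + _).
by rewrite deriveZ //; apply: diff_derivable; exact: dDF.
Unshelve. all: by end_near. Qed.

Lemma schwarz k m (A : set 'rV[R]_k) (F : 'rV[R]_k -> 'rV[R]_m) x u v :
  open A -> A x -> smooth_on A F ->
  'D_u (fun y => 'D_v F y) x = 'D_v (fun y => 'D_u F y) x.
Proof.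
move=> oA Ax sF.
have dF y : A y -> differentiable F y by move=> Ay; exact: (smooth_on_differentiable sF).
have dDF t y : A y -> differentiable (fun y => 'D_t F y) y.
  by move=> Ay; exact: (smooth_on_differentiable (smooth_on_derive t sF)).
have nA := near_open oA Ax.
have E u' v' i : 'D_u' (fun y => 'D_v' F y) x 0 i
   = 'D_u' (fun y => 'D_v' (fun z => F z 0 i : R^o) y) x.
  rewrite derive_mx ?mxE; last by apply: diff_derivable; exact: dDF.
  apply: near_eq_derive; near=> y.
  rewrite derive_mx ?mxE //; apply: diff_derivable; apply: dF; near: y; exact: nA.
apply/rowP => i; apply: etrans (E u v i) _; apply: etrans _ (esym (E v u i)).
exact: (schwarz_scalar u v oA Ax (smooth_on_coord i oA sF)).
Unshelve. all: by end_near. Qed.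

End smooth_on.

(** * Charts, coordinate changes and smooth functions on manifolds *)

(** The chain rule for a composite that is only known near x to be H.  Every
    coordinate change of tangent vectors below is an instance. *)
Lemma diff_chain (R : realType) (U V W : normedModType R) (F : U -> V)
    (G : V -> W) (H : U -> W) (x v : U) :
  differentiable F x -> differentiable G (F x) ->
  (\forall y \near x, G (F y) = H y) ->
  'd G (F x) ('d F x v) = 'd H x v.
Proof.
move=> dF dG GFH.
have dGF : differentiable (G \o F) x by exact: differentiable_comp.
have dH : differentiable H x by exact: near_eq_differentiable dGF.
have <- : 'd (G \o F) x v = 'd G (F x) ('d F x v) by rewrite diff_comp.
by rewrite -(deriveE v dH) -(deriveE v dGF); exact: near_eq_derive.
Qed.

Lemma diff_near_id (R : realType) (V : normedModType R) (F : V -> V) (x v : V) :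
  (\forall y \near x, F y = y) -> 'd F x v = v.
Proof.
move=> Fid.
have dF : differentiable F x.
  apply: near_eq_differentiable (ex_diff (is_diff_def := is_diff_id x)).
  by apply: filterS Fid => y ->.
by rewrite -(deriveE v dF) (near_eq_derive v Fid) derive_id.
Qed.

Section charts.
Context {R : realType} {T : topologicalType} {m : nat}.
Implicit Types c : chart R T m.

Lemma cmap_continuous_at c p : cdom c p -> {for p, continuous (cmap c)}.
Proof.
move=> cp; have := @cmap_continuous _ _ _ c.
rewrite continuous_open_subspace; last exact: cdom_open.
by apply; rewrite inE.
Qed.

Lemma cinv_continuous_at c p : cdom c p -> {for cmap c p, continuous (cinv c)}.
Proof.
move=> cp; have := @cinv_continuous _ _ _ c.
rewrite continuous_open_subspace; last exact: cimage_open.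
by apply; rewrite inE; exists p.
Qed.

Lemma nbhs_cdom c p : cdom c p -> nbhs p (cdom c).
Proof. by move=> cp; apply: open_nbhs_nbhs; split=> //; exact: cdom_open. Qed.

(** A chart is a homeomorphism onto an open set, so that a statement near
    cmap p can be checked on images of points near p. *)
Lemma chart_near c p (U : set T) : cdom c p -> nbhs p U ->
  \forall x \near cmap c p, exists y, [/\ cdom c y, U y, cmap c y = x & cinv c x = y].
Proof.
move=> cp nU.
have n1 : nbhs (cmap c p) (cmap c @` cdom c).
  by apply: open_nbhs_nbhs; split; [exact: cimage_open|exists p].
have n2 : nbhs (cmap c p) [set x | U (cinv c x)].
  by apply: (cinv_continuous_at cp); rewrite cmapK.
apply: filterS2 n1 n2 => x [y cy <-] /=; rewrite cmapK // => Uy.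
by exists y; split=> //; rewrite cmapK.
Qed.

Lemma chart_image_open c (U : set T) : open U -> open (cmap c @` (cdom c `&` U)).
Proof.
move=> oU; rewrite openE => _ [p [cp Up] <-].
have := chart_near cp (open_nbhs_nbhs (conj oU Up)).
by apply: filterS => x [y [cy Uy <- _]]; exists y.
Qed.

End charts.

Local Notation "'φ' q" := (cmap (chart_at q)) (at level 2, q at level 1).
Local Notation "'ψ' q" := (cinv (chart_at q)) (at level 2, q at level 1).
Local Notation dom q := (cdom (chart_at q)).

Section manifolds.
Context {R : realType} {m : nat} (M : manifold R m).
Implicit Types (p q a b c : M).

(** Change of components of a tangent vector at p, from the chart at a to the
    chart at b; [tcoord q p] is the case a = p, b = q. *)
Definition dtrans a b p : 'rV[R]_m -> 'rV[R]_m := 'd (φ b \o ψ a) (φ a p).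

Lemma tcoordE q p : tcoord q p = dtrans p q p.
Proof. by []. Qed.

Lemma tcoordD q p u v : tcoord q p (u + v) = tcoord q p u + tcoord q p v.
Proof. by rewrite /tcoord linearD. Qed.

Lemma tcoordZ q p (a : R) v : tcoord q p (a *: v) = a *: tcoord q p v.
Proof. by rewrite /tcoord linearZ. Qed.

Lemma dtransD a b p u v : dtrans a b p (u + v) = dtrans a b p u + dtrans a b p v.
Proof. by rewrite /dtrans linearD. Qed.

Lemma dtransZ a b p (c : R) v : dtrans a b p (c *: v) = c *: dtrans a b p v.
Proof. by rewrite /dtrans linearZ. Qed.

Lemma trans_differentiable a b p : dom a p -> dom b p ->
  differentiable (φ b \o ψ a) (φ a p).
Proof.
move=> ap bp; have := @smooth_on_differentiable _ _ _ _ _ (φ a p) (@chart_compatible _ _ M a b).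
by apply; exists p.
Qed.

Lemma dtransK a b c p v : dom a p -> dom b p -> dom c p ->
  dtrans b c p (dtrans a b p v) = dtrans a c p v.
Proof.
move=> ap bp cp; rewrite /dtrans.
have e : (φ b \o ψ a) (φ a p) = φ b p by rewrite /= (cmapK ap).
have d1 := trans_differentiable ap bp.
have d2 := trans_differentiable bp cp.
rewrite -e in d2 *.
apply: diff_chain d1 d2 _.
apply: filterS (chart_near ap (nbhs_cdom bp)) => x [y [ay by_ <- xy]] /=.
by rewrite (cmapK ay) (cmapK by_).
Qed.

Lemma dtrans_id a p v : dom a p -> dtrans a a p v = v.
Proof.
move=> ap; apply: diff_near_id.
apply: filterS (chart_near ap (nbhs_cdom ap)) => x [y [ay _ <- xy]] /=.
by rewrite (cmapK ay).
Qed.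

Lemma tcoord_id p v : tcoord p p v = v.
Proof. by rewrite tcoordE dtrans_id //; exact: mem_chart_at. Qed.

Lemma tcoord_trans a b p v : dom a p -> dom b p ->
  dtrans a b p (tcoord a p v) = tcoord b p v.
Proof. by move=> ap bp; rewrite dtransK //; exact: mem_chart_at. Qed.

Section smooth_fun.
Implicit Types W : normedModType R.

Lemma smooth_funW W (U U' : set M) (F : M -> W) :
  U' `<=` U -> smooth_fun U F -> smooth_fun U' F.
Proof.
move=> UU sF q; apply: smooth_onW (sF q) => _ [p [qp Up] <-].
by exists p => //; split=> //; exact: UU.
Qed.

Lemma smooth_fun_local W (U : set M) (F : M -> W) :
  (forall p, U p -> exists2 B, B p & smooth_fun B F) -> smooth_fun U F.
Proof.
move=> H q; apply: smooth_on_local => _ [p [qp Up] <-].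
have [B Bp sB] := H _ Up.
by exists (φ q @` (dom q `&` B)); [exists p|exact: sB].
Qed.

Lemma smooth_fun_eq W (U : set M) (F G : M -> W) : open U ->
  (forall p, U p -> F p = G p) -> smooth_fun U F -> smooth_fun U G.
Proof.
move=> oU FG sF q; apply: smooth_on_eq (sF q); first exact: chart_image_open.
by move=> _ [p [qp Up] <-] /=; rewrite cmapK // FG.
Qed.

Lemma smooth_funD W (U : set M) (F G : M -> W) : open U ->
  smooth_fun U F -> smooth_fun U G -> smooth_fun U (fun p => F p + G p).
Proof.
move=> oU sF sG q; apply: (smooth_onD _ (sF q) (sG q)).
exact: chart_image_open.
Qed.

Lemma smooth_fun_cst W (U : set M) (w : W) : smooth_fun U (fun=> w).
Proof. by move=> q; exact: smooth_on_cst. Qed.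

Lemma smooth_fun_scale W (U : set M) (a : M -> R^o) (F : M -> W) : open U ->
  smooth_fun U a -> smooth_fun U F -> smooth_fun U (fun p => a p *: F p).
Proof.
move=> oU sF sG q; apply: (smooth_on_scale _ (sF q) (sG q)).
exact: chart_image_open.
Qed.

Lemma smooth_fun_coord n (U : set M) (F : M -> 'rV[R]_n) i : open U ->
  smooth_fun U F -> smooth_fun U (fun p => F p 0 i : R^o).
Proof.
move=> oU sF q; apply: (smooth_on_coord i _ (sF q)).
exact: chart_image_open.
Qed.

Lemma smooth_fun_comp n W (U : set M) (B : set 'rV[R]_n)
    (G : M -> 'rV[R]_n) (F : 'rV[R]_n -> W) : open U ->
  (forall p, U p -> B (G p)) ->
  smooth_fun U G -> smooth_on B F -> smooth_fun U (F \o G).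
Proof.
move=> oU UB sG sF q.
have := @smooth_on_comp _ _ _ _ _ B (G \o ψ q) F (@chart_image_open _ _ _ (chart_at q) _ oU) _ (sG q) sF.
by apply => _ [p [qp Up] <-] /=; rewrite cmapK //; exact: UB.
Qed.

(** Differentials of smooth maps depend smoothly on the base point: this makes
    changes of chart harmless in the definition of smooth sections. *)
Lemma smooth_fun_diff n W (U : set M) (B : set 'rV[R]_n)
    (G H : M -> 'rV[R]_n) (F : 'rV[R]_n -> W) : open U ->
  (forall p, U p -> B (G p)) ->
  smooth_fun U G -> smooth_fun U H -> smooth_on B F ->
  smooth_fun U (fun p => 'd F (G p) (H p)).
Proof.
move=> oU UB sG sH sF q.
have := @smooth_on_diff _ _ _ _ _ B (G \o ψ q) (H \o ψ q) F (@chart_image_open _ _ _ (chart_at q) _ oU) _ (sG q) (sH q) sF.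
by apply => _ [p [qp Up] <-] /=; rewrite cmapK //; exact: UB.
Qed.

Lemma smooth_fun_chart q : smooth_fun (dom q) (φ q).
Proof. by move=> q'; exact: (@chart_compatible _ _ M). Qed.

End smooth_fun.

End manifolds.

Arguments smooth_fun_chart {R m M} q.
Arguments chart_image_open {R T m} c {U}.

(** * Smooth maps and sections along them *)

Lemma id_smooth_map (R : realType) (m : nat) (N : manifold R m) :
  smooth_map (fun p : N => p).
Proof. by split=> [p|q]; [exact: cvg_id|exact: smooth_fun_chart]. Qed.

Section maps.
Context {R : realType} {k m : nat} {M : manifold R k} {N : manifold R m}.
Context {f : M -> N} (sf : smooth_map f).

Lemma open_preim (U : set N) : open U -> open (f @^-1` U).
Proof. by move=> oU; apply: open_comp => // x _; have [cf _] := sf; exact: cf. Qed.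

Lemma open_preim_dom (q : N) : open (f @^-1` dom q).
Proof. exact: open_preim (cdom_open _). Qed.
Arguments open_preim_dom q : clear implicits.

Lemma smooth_fun_map (q : N) : smooth_fun (f @^-1` dom q) (φ q \o f).
Proof. by have [_] := sf. Qed.
Arguments smooth_fun_map q : clear implicits.

Lemma smooth_fun_pull (W : normedModType R) (U : set N) (G : N -> W) : open U ->
  smooth_fun U G -> smooth_fun (f @^-1` U) (G \o f).
Proof.
move=> oU sG; apply: smooth_fun_local => p Up.
have oB : open (f @^-1` (U `&` dom (f p))).
  by apply: open_preim; apply: openI => //; exact: cdom_open.
exists (f @^-1` (U `&` dom (f p))).
  by split=> //; exact: mem_chart_at.
have s1 : smooth_fun (f @^-1` (U `&` dom (f p))) (φ (f p) \o f).
  by apply: smooth_funW (smooth_fun_map (f p)) => x [].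
have s2 := smooth_fun_comp oB _ s1 (sG (f p)).
apply: (smooth_fun_eq oB) (s2 _) => [x [Ux dx] /=|x [Ux dx]].
  by rewrite cmapK.
by exists (f x).
Qed.

(** The differential of f is defined with the preferred charts at x and f x; in
    any other pair of charts it is the differential of the local expression. *)
Lemma tmap_chart (a : M) (b : N) (x : M) (v : 'rV[R]_k) : dom a x -> dom b (f x) ->
  tcoord b (f x) (tmap f x v) = 'd (φ b \o f \o ψ a) (φ a x) (tcoord a x v).
Proof.
move=> ax bx; rewrite /tmap lfunE /=.
have xx := mem_chart_at x; have fxx := mem_chart_at (f x).
have D (c : M) (d : N) : dom c x -> dom d (f x) -> differentiable (φ d \o f \o ψ c) (φ c x).
  move=> cx dx; have := @smooth_on_differentiable _ _ _ _ _ (φ c x) (smooth_fun_map d c).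
  by apply; exists x.
have D1 := D x (f x) xx fxx.
have D2 : differentiable (φ b \o ψ (f x)) ((φ (f x) \o f \o ψ x) (φ x x)).
  by rewrite /= (cmapK xx); exact: trans_differentiable.
have D3 := trans_differentiable xx ax.
have D4 : differentiable (φ b \o f \o ψ a) ((φ a \o ψ x) (φ x x)).
  by rewrite /= (cmapK xx); exact: D.
have nb : nbhs x (f @^-1` dom (f x) `&` f @^-1` dom b `&` dom a).
  apply: open_nbhs_nbhs; split=> //; apply: openI; last exact: cdom_open.
  by apply: openI; exact: open_preim_dom.
have H y : dom x y -> [/\ dom (f x) (f y), dom b (f y) & dom a y] ->
   (φ b \o ψ (f x)) ((φ (f x) \o f \o ψ x) (φ x y)) = (φ b \o f \o ψ a) ((φ a \o ψ x) (φ x y)).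
  by move=> xy [h1 h2 h3]; rewrite /= (cmapK xy) (cmapK h1) (cmapK h3).
have e1 : (φ (f x) \o f \o ψ x) (φ x x) = φ (f x) (f x) by rewrite /= (cmapK xx).
have e2 : (φ a \o ψ x) (φ x x) = φ a x by rewrite /= (cmapK xx).
pose H' := (φ b \o f \o ψ a) \o (φ a \o ψ x).
have N1 : \forall y \near φ x x,
    (φ b \o ψ (f x)) ((φ (f x) \o f \o ψ x) y) = H' y.
  apply: filterS (chart_near xx nb) => z [y [xy [[h1 h2] h3] <- _]].
  exact: H.
have N2 : \forall y \near φ x x, (φ b \o f \o ψ a) ((φ a \o ψ x) y) = H' y.
  by apply: filterE.
have E1 := diff_chain v D1 D2 N1.
have E2 := diff_chain v D3 D4 N2.
rewrite e1 in E1; rewrite e2 in E2.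
exact: etrans E1 (esym E2).
Qed.

Implicit Types (s t : M -> 'rV[R]_m).

(** One chart around each point is enough, since changes of chart are smooth. *)
Lemma smooth_section_local (U : set M) s : open U ->
  (forall p, U p -> exists (q : N) (B : set M),
     [/\ open B, B p, (forall x, B x -> dom q (f x)) &
      smooth_fun B (fun x => tcoord q (f x) (s x))]) ->
  smooth_section f U s.
Proof.
move=> oU H q'; apply: smooth_fun_local => p [Up q'p].
have [q [B [oB Bp Bq sB]]] := H p Up.
exists (B `&` f @^-1` dom q'); first by split.
have oB' : open (B `&` f @^-1` dom q') by apply: openI => //; exact: open_preim_dom.
have sB' : smooth_fun (B `&` f @^-1` dom q') (fun x => tcoord q (f x) (s x)).
  by apply: smooth_funW sB => x [].
have sf' : smooth_fun (B `&` f @^-1` dom q') (φ q \o f).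
  by apply: smooth_funW (smooth_fun_map q) => x [Bx _]; exact: Bq.
have s1 := smooth_fun_diff oB' _ sf' sB' (@chart_compatible _ _ N q q').
apply: (smooth_fun_eq oB') (s1 _) => [x [Bx dx]|x [Bx dx]]; last first.
  by exists (f x) => //; split=> //; exact: Bq.
by apply: (tcoord_trans _ (Bq _ Bx) dx).
Qed.

Lemma smooth_section_in (q : N) s : smooth_section f setT s ->
  smooth_fun (f @^-1` dom q) (fun x => tcoord q (f x) (s x)).
Proof. by move=> /(_ q); apply: smooth_funW => x. Qed.
Arguments smooth_section_in q {s} _.

Lemma smooth_section_of s :
  (forall q, smooth_fun (f @^-1` dom q) (fun x => tcoord q (f x) (s x))) ->
  smooth_section f setT s.
Proof. by move=> H q; apply: smooth_funW (H q) => x []. Qed.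

Lemma smooth_sectionD s t : smooth_section f setT s -> smooth_section f setT t ->
  smooth_section f setT (fun x => s x + t x).
Proof.
move=> ss st; apply: smooth_section_of => q.
have := smooth_funD (open_preim_dom q) (smooth_section_in q ss) (smooth_section_in q st).
apply: smooth_fun_eq => [|x _]; first exact: open_preim_dom.
by rewrite tcoordD.
Qed.

Lemma smooth_section_scale (a : M -> R^o) s : smooth_fun setT a -> smooth_section f setT s ->
  smooth_section f setT (fun x => a x *: s x).
Proof.
move=> sa ss; apply: smooth_section_of => q.
have sa' : smooth_fun (f @^-1` dom q) a by apply: smooth_funW sa.
have := smooth_fun_scale (open_preim_dom q) sa' (smooth_section_in q ss).
apply: smooth_fun_eq => [|x _]; first exact: open_preim_dom.
by rewrite tcoordZ.
Qed.

Lemma smooth_section_pull (V : N -> 'rV[R]_m) : smooth_vf V ->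
  smooth_section f setT (V \o f).
Proof.
move=> sV; apply: smooth_section_of => q.
apply: (smooth_fun_pull (cdom_open _) (G := fun y => tcoord q y (V y))).
by move: (sV q); apply: smooth_funW => x.
Qed.

Lemma smooth_section_push (X : M -> 'rV[R]_k) : smooth_vf X ->
  smooth_section f setT (fun x => tmap f x (X x)).
Proof.
move=> sX; apply: smooth_section_local; first exact: openT.
move=> p _; exists (f p), (dom p `&` f @^-1` dom (f p)).
have oB : open (dom p `&` f @^-1` dom (f p)).
  by apply: openI; [exact: cdom_open|exact: open_preim_dom].
split; [exact: oB|by split; exact: mem_chart_at|by move=> x []|].
have s1 : smooth_fun (dom p `&` f @^-1` dom (f p)) (φ p).
  by apply: smooth_funW (smooth_fun_chart p) => x [].
have s2 : smooth_fun (dom p `&` f @^-1` dom (f p)) (fun x => tcoord p x (X x)).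
  by move: (sX p); apply: smooth_funW => x [].
have s3 := smooth_fun_diff oB _ s1 s2 (smooth_fun_map (f p) p).
apply: (smooth_fun_eq oB) (s3 _) => [x [px fx]|x [px fx]]; last by exists x.
by rewrite (tmap_chart _ px fx).
Qed.

End maps.

Arguments smooth_section_in {R k m M N f} q {s} _.
Arguments smooth_fun_map {R k m M N f} sf q.
Arguments open_preim_dom {R k m M N f} sf q.

(** * Cutoff functions and cutoff coordinate fields *)

Section cutoff.
Context {R : realType} {m : nat} {N : manifold R m}.

(** A cutoff function turns an object defined on the chart at q only into a
    global one: the product with chi is smooth on the chart, and 0 on the open
    set C that covers the rest of N. *)
Record cutoff (q : N) (chi : N -> R^o) (U C : set N) : Prop := Cutoff {
  cutoff_smooth : smooth_fun setT chi;
  cutoff_openU : open U;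
  cutoff_U : U q;
  cutoff_dom : U `<=` dom q;
  cutoff1 : forall y, U y -> chi y = 1;
  cutoff_openC : open C;
  cutoff0 : forall y, C y -> chi y = 0;
  cutoff_cover : forall y, dom q y \/ C y
}.

(** The zero extension of a bump function of the chart is smooth because its
    support is compact, hence closed in the Hausdorff space N. *)
Lemma cutoff_exists q : exists chi U C, cutoff q chi U C.
Proof.
have qq := mem_chart_at q.
have [|b [K [sb b1 cK KO b0]]] := @bump_row R m (φ q q) (φ q @` dom q) (@cimage_open _ _ _ (chart_at q)).
  by exists q.
pose chi y : R^o := if y \in dom q then b (φ q y) else 0.
pose C := ~` (ψ q @` K).
have oC : open C.
  apply: closed_openC; apply: compact_closed; first exact: manifold_hausdorff.
  apply: continuous_compact => //.
  apply: continuous_subspaceW KO _; exact: (@cinv_continuous _ _ _ (chart_at q)).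
have chi0 y : C y -> chi y = 0.
  move=> Cy; rewrite /chi; case: ifPn => // /set_mem qy; apply: b0 => Ky.
  by apply: Cy; exists (φ q y) => //; rewrite cmapK.
have cov y : dom q y \/ C y.
  have [qy|nqy] := pselect (dom q y); [by left|right].
  by move=> [x /KO [z qz <-]]; rewrite cmapK // => zy; apply: nqy; rewrite -zy.
(* The open set U is the interior of the set of points of the chart where chi
   is 1. *)
have nU : nbhs q (dom q `&` [set y | b (φ q y) = 1]).
  apply: filterI; first exact: nbhs_cdom.
  exact: (cmap_continuous_at qq b1).
exists chi, (interior (dom q `&` [set y | b (φ q y) = 1])), C; split=> //.
- apply: smooth_fun_local => p _; have [pq|Cp] := cov p.
    exists (dom q) => //.
    have s1 := smooth_fun_comp (cdom_open (chart_at q)) (fun _ _ => I) (smooth_fun_chart q) sb.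
    apply: (smooth_fun_eq (cdom_open _)) s1 => y qy.
    by rewrite /chi mem_set.
  exists C => //.
  by apply: (smooth_fun_eq oC) (@smooth_fun_cst _ _ _ _ C 0) => y /chi0.
- exact: open_interior.
- by move=> y /interior_subset [].
- by move=> y /interior_subset [qy by1]; rewrite /chi mem_set.
Qed.

(** The cutoff of the vector field with constant components v in the chart at
    q. *)
Definition cutfield (q : N) (chi : N -> R^o) (v : 'rV[R]_m) (y : N) : 'rV[R]_m :=
  chi y *: dtrans q y y v.

Context {q : N} {chi : N -> R^o} {U C : set N} (Hc : cutoff q chi U C).

Lemma cutfieldD u v y : cutfield q chi (u + v) y = cutfield q chi u y + cutfield q chi v y.
Proof. by rewrite /cutfield dtransD scalerDr. Qed.

Lemma cutfieldZ (a : R) v y : cutfield q chi (a *: v) y = a *: cutfield q chi v y.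
Proof. by rewrite /cutfield dtransZ !scalerA mulrC. Qed.

Lemma cutfield_sum (v : 'rV[R]_m) y :
  cutfield q chi v y = \sum_i v 0 i *: cutfield q chi (delta_mx 0 i) y.
Proof.
rewrite [in LHS](row_sum_delta v).
have e0 : cutfield q chi 0 y = 0 by have := cutfieldZ 0 0 y; rewrite !scale0r.
have H (r : seq 'I_m) : cutfield q chi (\sum_(i <- r) v 0 i *: delta_mx 0 i) y
    = \sum_(i <- r) v 0 i *: cutfield q chi (delta_mx 0 i) y.
  elim: r => [|i r IH]; first by rewrite !big_nil e0.
  by rewrite !big_cons cutfieldD cutfieldZ IH.
exact: H.
Qed.

Lemma tcoord_cutfield v y : dom q y -> tcoord q y (cutfield q chi v y) = chi y *: v.
Proof.
move=> qy; rewrite tcoordZ tcoordE dtransK ?dtrans_id //; exact: mem_chart_at.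
Qed.

Lemma cutfield_id v : cutfield q chi v q = v.
Proof.
have qq := mem_chart_at q.
by rewrite /cutfield (cutoff1 Hc (cutoff_U Hc)) scale1r dtrans_id.
Qed.

Lemma tcoord_cutfield1 v y : U y -> tcoord q y (cutfield q chi v y) = v.
Proof.
by move=> Uy; rewrite (tcoord_cutfield _ (cutoff_dom Hc Uy)) (cutoff1 Hc Uy) scale1r.
Qed.

Lemma cutfield_smooth v : smooth_vf (cutfield q chi v).
Proof.
apply: (smooth_section_local (id_smooth_map N) openT) => p _.
have [qp|Cp] := cutoff_cover Hc p.
  exists q, (dom q); split=> //; first exact: cdom_open.
  have s1 : smooth_fun (dom q) (fun x => chi x *: v).
    apply: smooth_fun_scale; [exact: cdom_open| |exact: smooth_fun_cst].
    by apply: smooth_funW (cutoff_smooth Hc).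
  by apply: (smooth_fun_eq (cdom_open _)) s1 => y qy; rewrite tcoord_cutfield.
have oB : open (C `&` dom p) by apply: openI; [exact: cutoff_openC Hc|exact: cdom_open].
exists p, (C `&` dom p); split.
- exact: oB.
- by split=> //; exact: mem_chart_at.
- by move=> x [].
- apply: (smooth_fun_eq oB) (@smooth_fun_cst _ _ _ _ _ 0) => y [Cy _].
  by rewrite /cutfield (cutoff0 Hc Cy) tcoordZ scale0r.
Qed.

End cutoff.

(** * Tensorial operators on sections along a map *)

Section tensorial.
Context {R : realType} {k m : nat} {M : manifold R k} {N : manifold R m}.
Context {f : M -> N} (sf : smooth_map f).
Context {q : N} {chi : N -> R^o} {U C : set N} (Hc : cutoff q chi U C).

(** The components of the section s in the chart at q, cut off so that they are
    smooth on all of M. *)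
Definition frame_coef (s : M -> 'rV[R]_m) (i : 'I_m) (x : M) : R^o :=
  chi (f x) *: ((tcoord q (f x) (s x)) 0 i : R^o).

Lemma smooth_cutoff_map : smooth_fun setT (chi \o f).
Proof. exact: (smooth_fun_pull sf openT (cutoff_smooth Hc)). Qed.

Lemma smooth_frame_coef s i : smooth_section f setT s -> smooth_fun setT (frame_coef s i).
Proof.
move=> ss; apply: smooth_fun_local => p _.
have [qp|Cp] := cutoff_cover Hc (f p).
  exists (f @^-1` dom q) => //.
  have oB := open_preim_dom sf q.
  apply: (smooth_fun_scale oB); first exact: smooth_funW smooth_cutoff_map.
  exact: smooth_fun_coord oB (smooth_section_in q ss).
exists (f @^-1` C) => //.
apply: (smooth_fun_eq (open_preim sf (cutoff_openC Hc))) (@smooth_fun_cst _ _ _ _ _ 0) => x Cx.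
by rewrite /frame_coef (cutoff0 Hc Cx) scale0r.
Qed.

(** The square of the cutoff function appears because both the coefficients and
    the frame are cut off.  This is a global identity, which avoids having to
    localize operators that act on global sections only. *)
Lemma frame_expansion s x :
  (chi (f x) * chi (f x)) *: s x
  = \sum_i frame_coef s i x *: cutfield q chi (delta_mx 0 i) (f x).
Proof.
have -> : \sum_i frame_coef s i x *: cutfield q chi (delta_mx 0 i) (f x)
    = chi (f x) *: cutfield q chi (tcoord q (f x) (s x)) (f x).
  rewrite cutfield_sum scaler_sumr; apply: eq_bigr => i _.
  by rewrite [RHS]scalerA.
have [qx|Cx] := cutoff_cover Hc (f x); last by rewrite (cutoff0 Hc Cx) mul0r !scale0r.
rewrite /cutfield scalerA tcoordE dtransK ?dtrans_id //; exact: mem_chart_at.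
Qed.

Lemma smooth_section0 : smooth_section f setT (fun=> 0).
Proof.
apply: smooth_section_of => q'.
apply: (smooth_fun_eq (open_preim_dom sf q')) (@smooth_fun_cst _ _ _ _ _ 0) => x _.
by have := tcoordZ q' (f x) 0 0; rewrite !scale0r.
Qed.

Lemma smooth_section_sum (I : Type) (r : seq I) (s : I -> M -> 'rV[R]_m) :
  (forall i, smooth_section f setT (s i)) ->
  smooth_section f setT (fun x => \sum_(i <- r) s i x).
Proof.
move=> ss; elim: r => [|i r IH].
  have -> : (fun x => \sum_(i <- [::]) s i x) = (fun=> 0).
    by apply/funext => x; rewrite big_nil.
  exact: smooth_section0.
have -> : (fun x => \sum_(j <- i :: r) s j x) = (fun x => s i x + \sum_(j <- r) s j x).
  by apply/funext => x; rewrite big_cons.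
exact: smooth_sectionD.
Qed.

(** By [frame_expansion], chi^2 s is a combination of the cutoff frame with
    smooth coefficients, and chi(q) = 1. *)
Lemma tensorial_cutfield (W : lmodType R) (T : (M -> 'rV[R]_m) -> W) (p : M) s :
  f p = q ->
  (forall s t, smooth_section f setT s -> smooth_section f setT t ->
     T (fun x => s x + t x) = T s + T t) ->
  (forall (a : M -> R^o) s, smooth_fun setT a -> smooth_section f setT s ->
     T (fun x => a x *: s x) = a p *: T s) ->
  smooth_section f setT s ->
  T s = T (cutfield q chi (s p) \o f).
Proof.
move=> fp TD TZ ss.
pose E i := cutfield q chi (delta_mx 0 i) \o f.
have sE i : smooth_section f setT (E i) by apply: smooth_section_pull => //; exact: cutfield_smooth Hc _.
have T0 : T (fun=> 0) = 0.
  have -> : (fun=> 0) = (fun x : M => (0 : R^o) *: (0 : 'rV[R]_m)).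
    by apply/funext => x; rewrite scale0r.
  rewrite (TZ (fun=> 0)) ?scale0r //; [exact: smooth_fun_cst|exact: smooth_section0].
have Tsum (a : 'I_m -> M -> R^o) : (forall i, smooth_fun setT (a i)) ->
    T (fun x => \sum_i a i x *: E i x) = \sum_i a i p *: T (E i).
  move=> sa; elim: (index_enum _) => [|i r IH].
    rewrite big_nil -T0; congr T; apply/funext => x; by rewrite big_nil.
  rewrite big_cons -IH -TZ // -TD.
  - by congr T; apply/funext => x; rewrite big_cons.
  - exact: smooth_section_scale.
  - by apply: smooth_section_sum => j; exact: smooth_section_scale.
have chi1 : chi (f p) = 1 by rewrite fp (cutoff1 Hc (cutoff_U Hc)).
have -> : T s = T (fun x => (chi (f x) : R^o) *: ((chi (f x) : R^o) *: s x)).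
  rewrite TZ ?TZ ?chi1 ?scale1r //; try exact: smooth_cutoff_map.
  by apply: smooth_section_scale => //; exact: smooth_cutoff_map.
have -> : (fun x => (chi (f x) : R^o) *: ((chi (f x) : R^o) *: s x))
    = (fun x => \sum_i frame_coef s i x *: E i x).
  by apply/funext => x; rewrite scalerA frame_expansion.
rewrite Tsum => [|i]; last exact: smooth_frame_coef.
have -> : cutfield q chi (s p) \o f = (fun x => \sum_i ((s p) 0 i : R^o) *: E i x).
  by apply/funext => x; rewrite /= cutfield_sum.
rewrite (Tsum (fun i => fun=> (s p) 0 i)) => [|i]; last exact: smooth_fun_cst.
apply: eq_bigr => i _; congr (_ *: _).
by rewrite /frame_coef chi1 scale1r fp tcoord_id.
Qed.

End tensorial.

(** On a neighbourhood where chi = 1, Phi s is a combination of the smooth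
    sections Phi E_i, for E_i the cutoff frame. *)
Lemma smooth_section_act (R : realType) (k m : nat) (M : manifold R k)
    (N : manifold R m) (f : M -> N) (Phi : N -> 'End('rV[R]_m)) s :
  smooth_map f ->
  (forall V, smooth_vf V -> smooth_vf (act_on Phi V)) ->
  smooth_section f setT s -> smooth_section f setT (fun x => Phi (f x) (s x)).
Proof.
move=> sf sPhi ss; apply: (smooth_section_local sf openT) => p _.
have [chi [U [C Hc]]] := cutoff_exists (f p).
pose E i := act_on Phi (cutfield (f p) chi (delta_mx 0 i)) \o f.
have sE i : smooth_section f setT (E i).
  by apply: smooth_section_pull => //; apply: sPhi; exact: cutfield_smooth Hc _.
have s1 : smooth_section f setT (fun x => \sum_i frame_coef (f := f) (q := f p) (chi := chi) s i x *: E i x).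
  apply: smooth_section_sum => // i; apply: smooth_section_scale => //.
  exact: smooth_frame_coef Hc _ _ ss.
have oB := open_preim sf (cutoff_openU Hc).
exists (f p), (f @^-1` U); split.
- exact: oB.
- exact: cutoff_U Hc.
- by move=> x /(cutoff_dom Hc).
- have s2 : smooth_fun (f @^-1` U)
      (fun x => tcoord (f p) (f x) (\sum_i frame_coef (f := f) (q := f p) (chi := chi) s i x *: E i x)).
    by apply: smooth_funW (smooth_section_in _ s1) => x /(cutoff_dom Hc).
  apply: (smooth_fun_eq oB) s2 => x Ux; congr (tcoord _ _ _).
  have -> : s x = \sum_i frame_coef (f := f) (q := f p) (chi := chi) s i x *: cutfield (f p) chi (delta_mx 0 i) (f x).
    by rewrite -(frame_expansion Hc) (cutoff1 Hc Ux) mulr1 scale1r.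
  rewrite linear_sum; apply: eq_bigr => i _; by rewrite linearZ.
Qed.

(** * The torsion of an induced connection *)

Section along.
Context {R : realType} {k m : nat} {M : manifold R k} {N : manifold R m}.
Context {f : M -> N} (sf : smooth_map f).
Implicit Types (X Y : M -> 'rV[R]_k) (s t : M -> 'rV[R]_m) (p : M).

Definition sec_in_chart p s (x : 'rV[R]_k) : 'rV[R]_m :=
  tcoord (f p) (f (ψ p x)) (s (ψ p x)).

Lemma sec_in_chart_at p s : sec_in_chart p s (φ p p) = s p.
Proof. by rewrite /sec_in_chart (cmapK (mem_chart_at p)) tcoord_id. Qed.

Lemma sec_in_chart_differentiable p s : smooth_section f setT s ->
  differentiable (sec_in_chart p s) (φ p p).
Proof.
move=> ss.
have := @smooth_on_differentiable _ _ _ _ _ (φ p p) (smooth_section_in (f p) ss p).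
by apply; exists p => //; split; exact: mem_chart_at.
Qed.

Lemma fun_in_chart_differentiable p (a : M -> R^o) : smooth_fun setT a ->
  differentiable (a \o ψ p) (φ p p).
Proof.
move=> sa; have := @smooth_on_differentiable _ _ _ _ _ (φ p p) (sa p).
by apply; exists p => //; split=> //; exact: mem_chart_at.
Qed.

Lemma sec_in_chart_cutfield p chi U C v : cutoff (f p) chi U C ->
  \forall x \near φ p p, sec_in_chart p (cutfield (f p) chi v \o f) x = v.
Proof.
move=> Hc.
have nU : nbhs p (f @^-1` U).
  apply: open_nbhs_nbhs; split; last exact: cutoff_U Hc.
  exact (open_preim sf (cutoff_openU Hc)).
apply: filterS (chart_near (mem_chart_at p) nU) => x [y [py Uy <- e]].
by rewrite /sec_in_chart /= e (tcoord_cutfield1 Hc).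
Qed.

Variables (D : (M -> 'rV[R]_k) -> (M -> 'rV[R]_m) -> M -> 'rV[R]_m).
Hypothesis (HD : connection_along f D).

(** By the Leibniz rule, D_X s minus the derivative of the components of s is
    tensorial in s; on the cutoff field the components are constant near p. *)
Lemma conn_local X s p chi U C : cutoff (f p) chi U C ->
  smooth_vf X -> smooth_section f setT s ->
  D X s p = 'D_(X p) (sec_in_chart p s) (φ p p)
            + D X (cutfield (f p) chi (s p) \o f) p.
Proof.
move=> Hc sX ss.
pose T s := D X s p - 'D_(X p) (sec_in_chart p s) (φ p p).
have H : T s = T (cutfield (f p) chi (s p) \o f).
  apply: (tensorial_cutfield sf Hc (T := T) (p := p)) => //.
  - move=> t u st su; rewrite /T (conn_addr HD) //.
    have -> : sec_in_chart p (fun x => t x + u x) = sec_in_chart p t + sec_in_chart p u.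
      by apply/funext => x; rewrite /sec_in_chart tcoordD.
    rewrite deriveD; try by apply: diff_derivable; exact: sec_in_chart_differentiable.
    by rewrite opprD addrACA.
  - move=> a t sa st; rewrite /T (conn_leibniz HD) //.
    have -> : sec_in_chart p (fun x => a x *: t x)
       = (fun x => (a \o ψ p) x *: sec_in_chart p t x).
      by apply/funext => x; rewrite /sec_in_chart tcoordZ.
    rewrite derive_scale; last 2 first.
    + exact: fun_in_chart_differentiable.
    + exact: sec_in_chart_differentiable.
    rewrite sec_in_chart_at [(a \o ψ p) _]/= (cmapK (mem_chart_at p)) scalerBr /vf_act.
    by rewrite [X in _ - X]addrC opprD addrACA subrr add0r.
rewrite {1}/T in H; apply/eqP; rewrite addrC -subr_eq H /T.
rewrite (near_eq_derive _ (sec_in_chart_cutfield (s p) Hc)).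
by rewrite derive_cst subr0.
Qed.

Variable (nab : (N -> 'rV[R]_m) -> (N -> 'rV[R]_m) -> N -> 'rV[R]_m).
Hypothesis Hcompat : forall X V W, smooth_vf X -> smooth_vf V -> smooth_vf W ->
    forall p, W (f p) = tmap f p (X p) -> D X (V \o f) p = nab W V (f p).
Hypothesis Htors : forall V W, smooth_vf V -> smooth_vf W ->
    forall q, nab V W q - nab W V q = lie_bracket V W q.

Lemma vf_in_chart_cutfield (q : N) chi U C v : cutoff q chi U C ->
  \forall x \near φ q q, vf_in_chart q (cutfield q chi v) x = v.
Proof.
move=> Hc.
have nU : nbhs q U by apply: open_nbhs_nbhs; split; [exact: cutoff_openU Hc|exact: cutoff_U Hc].
apply: filterS (chart_near (mem_chart_at q) nU) => x [y [py Uy <- e]].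
by rewrite /vf_in_chart /= e (tcoord_cutfield1 Hc).
Qed.

(** Both fields have constant components near q. *)
Lemma lie_bracket_cutfield (q : N) chi U C u v : cutoff q chi U C ->
  lie_bracket (cutfield q chi u) (cutfield q chi v) q = 0.
Proof.
move=> Hc; rewrite /lie_bracket.
rewrite (near_eq_derive _ (vf_in_chart_cutfield u Hc)) (near_eq_derive _ (vf_in_chart_cutfield v Hc)).
by rewrite !derive_cst subrr.
Qed.

Lemma vf_in_chart_differentiable X p : smooth_vf X ->
  differentiable (vf_in_chart p X) (φ p p).
Proof.
move=> sX; have := @smooth_on_differentiable _ _ _ _ _ (φ p p) (sX p p).
by apply; exists p => //; split; [exact: mem_chart_at|split=> //; exact: mem_chart_at].
Qed.

Lemma tmapE p (v : 'rV[R]_k) : tmap f p v = 'd (φ (f p) \o f \o ψ p) (φ p p) v.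
Proof. by rewrite /tmap lfunE. Qed.

(** The components of f_* Y are dF(Y), for F the expression of f in charts; this
    is the product rule [derive_diff]. *)
Lemma derive_push X Y p : smooth_vf Y ->
  'D_(X p) (sec_in_chart p (fun x => tmap f x (Y x))) (φ p p)
  = tmap f p ('D_(X p) (vf_in_chart p Y) (φ p p))
    + 'D_(X p) (fun x => 'D_(Y p) (φ (f p) \o f \o ψ p) x) (φ p p).
Proof.
move=> sY.
pose A := φ p @` (dom p `&` f @^-1` dom (f p)).
have oA : open A by apply: chart_image_open; exact: open_preim_dom.
have Ap : A (φ p p) by exists p => //; split; exact: mem_chart_at.
have Y0 : vf_in_chart p Y (φ p p) = Y p.
  by rewrite /vf_in_chart /= cmapK ?tcoord_id //; exact: mem_chart_at.
have sF : smooth_on A (φ (f p) \o f \o ψ p) by exact: (smooth_fun_map sf (f p) p).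
pose F := φ (f p) \o f \o ψ p.
have E : 'D_(X p) (fun y => 'd F y (vf_in_chart p Y y)) (φ p p)
  = 'd F (φ p p) ('D_(X p) (vf_in_chart p Y) (φ p p))
    + 'D_(X p) (fun y => 'D_(Y p) F y) (φ p p).
  have := derive_diff (X p) oA Ap sF (vf_in_chart_differentiable p sY).
  by move: (vf_in_chart p Y (φ p p)) Y0 => y0 ->.
have E' := congr1 (fun w => w + 'D_(X p) (fun y => 'D_(Y p) F y) (φ p p))
  (tmapE p ('D_(X p) (vf_in_chart p Y) (φ p p))).
apply: etrans (etrans _ E) (esym E').
apply: near_eq_derive.
apply: filterS (near_open oA Ap) => _ [y [py fy] <-].
rewrite /sec_in_chart /vf_in_chart /= (cmapK py).
exact: tmap_chart.
Qed.

(** After [conn_local], the cutoff fields contribute the torsion of nab, that is,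
    their bracket, which is 0; the derivatives of components contribute f_*[X, Y]
    and two second derivatives of f that cancel by symmetry. *)
Lemma torsion_along X Y p : smooth_vf X -> smooth_vf Y ->
  D X (fun x => tmap f x (Y x)) p - D Y (fun x => tmap f x (X x)) p
  = tmap f p (lie_bracket X Y p).
Proof.
move=> sX sY.
have [chi [U [C Hc]]] := cutoff_exists (f p).
rewrite (conn_local Hc sX (smooth_section_push sf sY)).
rewrite (conn_local Hc sY (smooth_section_push sf sX)).
rewrite (Hcompat sX (cutfield_smooth Hc (tmap f p (Y p))) (cutfield_smooth Hc (tmap f p (X p)))); last first.
  by rewrite (cutfield_id Hc).
rewrite (Hcompat sY (cutfield_smooth Hc (tmap f p (X p))) (cutfield_smooth Hc (tmap f p (Y p)))); last first.
  by rewrite (cutfield_id Hc).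
rewrite opprD addrACA (Htors (cutfield_smooth Hc _) (cutfield_smooth Hc _)) (lie_bracket_cutfield _ _ Hc) addr0.
pose A := φ p @` (dom p `&` f @^-1` dom (f p)).
have oA : open A by apply: chart_image_open; exact: open_preim_dom.
have Ap : A (φ p p) by exists p => //; split; exact: mem_chart_at.
rewrite (derive_push _ _ sY) (derive_push _ _ sX).
have S := schwarz (X p) (Y p) oA Ap (smooth_fun_map sf (f p) p).
have H (a b c d : 'rV[R]_m) : b = d -> a + b - (c + d) = a - c.
  by move=> ->; rewrite opprD addrACA subrr addr0.
apply: etrans (H _ _ _ _ S) _.
by rewrite /lie_bracket linearB.
Qed.

End along.

(** * Statistical structures: the dual connection *)

Section perp.
Context {R : realType} {m : nat} (g : bilinear_form R m).
Implicit Types (U V : {vspace 'rV[R]_m}) (u v : 'rV[R]_m).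

Lemma perpP U v : reflect (forall u, u \in U -> g u v = 0) (v \in perp g U).
Proof.
have E (s : seq 'rV[R]_m) :
    (v \in \bigcap_(u <- s) lker (g u))%VS = all (fun u => g u v == 0) s.
  by elim: s => [|u s IH]; rewrite ?big_nil ?memvf // big_cons memv_cap memv_ker IH.
rewrite /perp E; apply: (iffP allP) => [H u uU|H u uU].
  rewrite (coord_vbasis uU) linear_sum sum_lfunE big1 // => i _.
  rewrite linearZ /= scale_lfunE (eqP (H _ _)) ?scaler0 //.
  by rewrite mem_nth // size_tuple.
by apply/eqP/H; exact: vbasis_mem.
Qed.

Lemma nondegenerateP v : nondegenerate_on g fullv ->
  (forall u, g u v = 0) -> v = 0.
Proof.
move=> nd H; apply/eqP; rewrite -memv0 -nd memv_cap memvf /=.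
by apply/perpP => u _.
Qed.
End perp.

Section dual.
Context {R : realType} {m : nat} {N : manifold R m} {q : nat}.
Context {g : N -> bilinear_form R m}.
Context {nab nabs : (N -> 'rV[R]_m) -> (N -> 'rV[R]_m) -> N -> 'rV[R]_m}.

(** The tensor C(X, Y, Z) = (nab_X g)(Y, Z) is symmetric in its last two
    arguments and, by the Codazzi equation, in the first two, hence totally
    symmetric; duality says that C(X, Z, Y) = g(Z, nabs_X Y - nab_X Y).  So
    nabs - nab is symmetric and nabs has the torsion of nab. *)
Lemma dual_torsion_free : semi_riemannian_metric q g ->
  statistical_structure g nab nabs ->
  forall X Y, smooth_vf X -> smooth_vf Y ->
    forall p, nabs X Y p - nabs Y X p = lie_bracket X Y p.
Proof.
move=> Hg Hs X Y sX sY p.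
have gs := Defs.metric_sym Hg p.
have sym A B Z : nabla_metric nab g A B Z p = nabla_metric nab g A Z B p.
  rewrite /nabla_metric.
  have -> : (fun y => g y (B y) (Z y)) = (fun y => g y (Z y) (B y)).
    by apply/funext => y; exact: Defs.metric_sym Hg y _ _.
  by rewrite (gs (nab A B p)) (gs (B p) (nab A Z p)) addrAC.
have C A B Z : smooth_vf A -> smooth_vf B -> smooth_vf Z ->
    nabla_metric nab g A B Z p = g p (B p) (nabs A Z p - nab A Z p).
  move=> sA sB sZ; rewrite /nabla_metric (stat_dual Hs) // linearB.
  by rewrite (addrC (g p (nab A B p) (Z p))) addrK.
suff : nabs X Y p - nab X Y p - (nabs Y X p - nab Y X p) = 0.
  have H (a b c d : 'rV[R]_m) : a - b - (c - d) = 0 -> a - c = b - d.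
    move/eqP; rewrite subr_eq0 => /eqP h; apply/eqP; rewrite subr_eq; apply/eqP.
    by rewrite -(subrK b a) h [LHS]addrC addrA addrAC.
  by move/H => ->; exact: stat_torsion_free Hs _ _ sX sY p.
apply: (nondegenerateP (metric_nondegenerate Hg p)) => z.
have [chi [U [V Hc]]] := cutoff_exists p.
have sZ := cutfield_smooth Hc z; have Zp := cutfield_id Hc z.
rewrite linearB /= -Zp -(C _ _ _ sX sZ sY) -(C _ _ _ sY sZ sX).
apply/eqP; rewrite subr_eq0; apply/eqP.
by rewrite sym (stat_codazzi Hs).
Qed.
End dual.

(** * The Kenmotsu condition along a map *)

(** The commutator of a linear map with a sum of two connections is tensorial:
    the derivative terms c u of the Leibniz rule drop out. *)
Lemma leibniz_cancel (R : realType) (m : nat) (L : 'End('rV[R]_m)) (c a : R) u A B A' B' :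
  (c *: L u + a *: A) + (c *: L u + a *: B)
    - L ((c *: u + a *: A') + (c *: u + a *: B'))
  = a *: (A + B - L (A' + B')).
Proof.
rewrite (addrACA (c *: u)) (addrACA (c *: L u)) -!scalerDr !linearD !linearZ /=.
by rewrite addrACA !scalerN -[X in _ + X + _]opprD subrr add0r.
Qed.

Section phi.
Context {R : realType} {n k q r : nat} {N : manifold R n.*2.+1}.
Context {g : N -> bilinear_form R n.*2.+1}.
Context {nab nabs : (N -> 'rV[R]_n.*2.+1) -> (N -> 'rV[R]_n.*2.+1) -> N -> 'rV[R]_n.*2.+1}.
Context {phi : N -> 'End('rV[R]_n.*2.+1)} {nu : N -> 'rV[R]_n.*2.+1}.
Context {eta : N -> 'Hom('rV[R]_n.*2.+1, R^o)}.
Hypothesis HN : indefinite_kenmotsu_statistical q g nab nabs phi nu eta.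
Context {M : manifold R k} {f : M -> N} (sf : smooth_map f).
Context {D Ds : (M -> 'rV[R]_k) -> (M -> 'rV[R]_n.*2.+1) -> M -> 'rV[R]_n.*2.+1}.
Hypotheses (HD : induced_connection f nab D) (HDs : induced_connection f nabs Ds).

(** The difference of the two sides is tensorial in s, and on V o f with V a
    field of N it vanishes by the Kenmotsu condition. *)
Lemma phi_along X s p : smooth_vf X -> smooth_section f setT s ->
  D X (fun x => phi (f x) (s x)) p + Ds X (fun x => phi (f x) (s x)) p
  = phi (f p) (D X s p + Ds X s p)
    + 2 *: (eta (f p) (s p) *: phi (f p) (tmap f p (X p))
            - g (f p) (phi (f p) (tmap f p (X p))) (s p) *: nu (f p)).
Proof.
move=> sX ss.
have [chi [U [C Hc]]] := cutoff_exists (f p).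
have sphi := phi_smooth (ks_contact HN).
have cD := induced_conn HD; have cDs := induced_conn HDs.
(* The defect of commutation of phi with D + Ds, as an operator on sections. *)
pose P (s : M -> 'rV[R]_n.*2.+1) x := phi (f x) (s x).
have sP t : smooth_section f setT t -> smooth_section f setT (P t).
  exact: smooth_section_act.
pose T s := D X (P s) p + Ds X (P s) p - phi (f p) (D X s p + Ds X s p).
have H : T s = T (cutfield (f p) chi (s p) \o f).
  apply: (tensorial_cutfield sf Hc (T := T) (p := p)) => //.
  - move=> t u st su; rewrite /T.
    have -> : P (fun x => t x + u x) = (fun x => P t x + P u x).
      by apply/funext => x; rewrite /P linearD.
    rewrite !(conn_addr cD) ?(conn_addr cDs) //; try exact: sP.
    rewrite [in X in phi _ X]addrACA linearD.
    by rewrite opprD (addrACA (D X (P t) p)) [LHS]addrACA.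
  - move=> a t sa st; rewrite /T.
    have -> : P (fun x => a x *: t x) = (fun x => a x *: P t x).
      by apply/funext => x; rewrite /P linearZ.
    rewrite !(conn_leibniz cD) ?(conn_leibniz cDs) //; try exact: sP.
    exact: leibniz_cancel.
rewrite [RHS]addrC; apply/eqP; rewrite -subr_eq; apply/eqP.
rewrite -[LHS]/(T s) H /T.
set V := cutfield (f p) chi (s p).
have sV : smooth_vf V := cutfield_smooth Hc _.
pose W := cutfield (f p) chi (tmap f p (X p)).
have sW : smooth_vf W := cutfield_smooth Hc _.
have Wp : W (f p) = tmap f p (X p) := cutfield_id Hc _.
have Vp : V (f p) = s p := cutfield_id Hc _.
rewrite -[P (V \o f)]/(act_on phi V \o f).
rewrite !(induced_compat HD sX _ sW Wp) // ?(induced_compat HDs sX _ sW Wp) //; try exact: sphi.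
have := ks_nabla_phi HN sW sV (f p).
rewrite Wp Vp => <-.
by rewrite /levi_civita linearZ /= -scalerBr scalerA divff ?pnatr_eq0 // scale1r.
Qed.

End phi.

(** * Linear algebra of contact CR-lightlike submanifolds *)

Lemma daddv_pi_eq0 (K : fieldType) (vT : vectType K) (U V : {vspace vT}) v :
  (U :&: V = 0)%VS -> v \in V -> daddv_pi U V v = 0.
Proof.
move=> UV0 vV.
have vUV : v \in (U + V)%VS by rewrite -[v]add0r memv_add ?mem0v.
have := daddv_pi_add UV0 vUV.
rewrite (daddv_pi_id _ vV); last by rewrite capvC.
by move/eqP; rewrite -subr_eq0 addrK => /eqP.
Qed.

Lemma family_span (F : fieldType) (vT : vectType F) r (e : 'I_r -> vT) v :
  v \in <<[seq e i | i <- enum 'I_r]>>%VS -> exists c : 'I_r -> F, v = \sum_i c i *: e i.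
Proof.
rewrite span_def big_map big_enum /= => /memv_sumP[w wP ->].
have cP i : exists c, w i = c *: e i by apply/vlineP; exact: wP.
exists (fun i => projT1 (cid (cP i))); apply: eq_bigr => i _.
by case: (cid (cP i)).
Qed.

Section CR.
Context {R : realType} {n k q r : nat} {N : manifold R n.*2.+1}.
Context {g : N -> bilinear_form R n.*2.+1}.
Context {nab nabs : (N -> 'rV[R]_n.*2.+1) -> (N -> 'rV[R]_n.*2.+1) -> N -> 'rV[R]_n.*2.+1}.
Context {phi : N -> 'End('rV[R]_n.*2.+1)} {nu : N -> 'rV[R]_n.*2.+1}.
Context {eta : N -> 'Hom('rV[R]_n.*2.+1, R^o)}.
Hypothesis HN : indefinite_kenmotsu_statistical q g nab nabs phi nu eta.
Context {M : manifold R k} {f : M -> N}.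
Context {scr str ltr D0 D' L1 : M -> {vspace 'rV[R]_n.*2.+1}}.
Hypothesis HM : contact_CR_lightlike f g phi nu r scr str ltr D0 D' L1.

Let ll := cr_lightlike HM.
Let ct := ks_contact HN.

(** If l + s is tangent with l in ltr(TM) and s in S(TM^perp), pairing with the
    basis xi_i of the radical kills s and reads off the components of l in the
    dual family N_i, so that l = 0.  Then s is tangent and normal, hence in the
    radical, which meets S(TM^perp) trivially. *)
Lemma transversal_tangent_disjoint p :
  (transversal_bundle str ltr p :&: tangent_bundle f p)%VS = 0%VS.
Proof.
apply/eqP; rewrite -subv0; apply/subvP => v /memv_capP[/memv_addP[l lL [s sS ->]] vT].
have [U [xi [nn [_ Up _ /(_ p Up)[bxi ltrE _ gx]]]]] := ll_transversal ll p.
have [TE TI _] := ll_screen_transversal ll p.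
have sN : s \in normal_bundle f g p by rewrite TE (subvP (addvSr _ _)).
have gs := Defs.metric_sym (ks_metric HN) (f p).
have xiR i : xi i p \in radical f g p.
  by apply: (basis_mem bxi); apply: map_f; rewrite mem_enum.
have l0 : l = 0.
  rewrite ltrE in lL; have [c lE] := family_span lL.
  rewrite lE big1 // => i _; have -> : c i = 0; last by rewrite scale0r.
  have : g (f p) (xi i p) (l + s) = 0.
    rewrite gs; have /memv_capP[_ /perpP] := xiR i; exact.
  rewrite linearD /= [X in _ + X](_ : _ = 0) ?addr0; last first.
    by have /perpP := sN; apply; have /memv_capP[] := xiR i.
  rewrite lE linear_sum (bigD1 i) //= big1 ?addr0 => [|j ji].
    by rewrite linearZ /= (gx i i).1 eqxx /GRing.scale /= mulr1.
  by rewrite linearZ /= (gx i j).1 eq_sym (negPf ji) scaler0.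
rewrite l0 add0r in vT *.
by rewrite -TI memv_cap sS andbT memv_cap vT.
Qed.

(** In fact phi(nu) = 0; here phi^2 nu = 0, so the formula for phi^2 at phi(nu)
    makes phi(nu) a multiple of nu. *)
Lemma phi_nu_tangent p : phi (f p) (nu (f p)) \in tangent_bundle f p.
Proof.
have e1 : phi (f p) (phi (f p) (nu (f p))) = 0.
  by rewrite (phi_sq ct) -(eta_dual ct) (nu_unit ct) scale1r addNr.
have := phi_sq ct (f p) (phi (f p) (nu (f p))).
rewrite e1 linear0 => /esym/eqP; rewrite addrC subr_eq0 => /eqP <-.
by rewrite memvZ // (cr_nu_tangent HM).
Qed.

Lemma scr_tangent p : (scr p <= tangent_bundle f p)%VS.
Proof. by have [-> _ _] := ll_screen ll p; exact: addvSr. Qed.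

Lemma D0_tangent p : (D0 p <= tangent_bundle f p)%VS.
Proof.
apply: subv_trans (scr_tangent p); have [-> _ _] := cr_screen HM p.
apply: subv_trans (addvSl _ _); exact: addvSr.
Qed.

(** phi exchanges Rad(TM) and phi(Rad(TM)) up to multiples of nu, and preserves
    D0. *)
Lemma phi_D_nu_tangent p w : w \in D_nu f g phi nu D0 p ->
  phi (f p) w \in tangent_bundle f p.
Proof.
move=> /memv_addP[w1 /memv_addP[w2 /memv_addP[a aR [b bR ->]] [d dD ->]] [e /vlineP[c ->] ->]].
rewrite !linearD linearZ /=.
apply: memvD; last by rewrite memvZ // phi_nu_tangent.
apply: memvD; last first.
  by apply: (subvP (D0_tangent p)); rewrite -(cr_D0_invariant HM p) memv_img.
apply: memvD.
  by apply: (subvP (cr_phi_radical_tangent HM p)); exact: memv_img.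
have /memv_imgP[b0 b0R ->] := bR; rewrite (phi_sq ct) memvD ?memvZ ?(cr_nu_tangent HM) //.
by rewrite memvN; have /memv_capP[] := b0R.
Qed.

Local Notation proj p := (daddv_pi (transversal_bundle str ltr p) (tangent_bundle f p)).

(** Write w as a D'-component d plus a vector of D + {nu}: the projection of
    phi w is phi d.  If phi d = 0, then d = eta(d) nu by the formula for phi^2, so
    that w lies in D + {nu}. *)
Lemma proj_phi_eq0 p w : w \in tangent_bundle f p ->
  (proj p (phi (f p) w) = 0 <-> w \in D_nu f g phi nu D0 p).
Proof.
move=> wT; split; last first.
  by move=> /phi_D_nu_tangent; exact: daddv_pi_eq0 (transversal_tangent_disjoint p).
have [TE _ _] := ll_screen ll p; have [SE _ _] := cr_screen HM p.
rewrite TE SE in wT.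
move: wT => /memv_addP[a aR [w1 /memv_addP[w2 /memv_addP[w3 /memv_addP[b bR [d dD' ->]] [d0 dD0 ->]] [e eN ->]] ->]].
have -> : a + (b + d + d0 + e) = d + (a + b + d0 + e).
  by rewrite (addrAC b d) (addrAC _ d) addrA [LHS]addrC !addrA -!addrA (addrCA d) ; rewrite !addrA addrC !addrA.
have inD : a + b + d0 + e \in D_nu f g phi nu D0 p.
  by rewrite /D_nu !memv_add.
have -> : phi (f p) (d + (a + b + d0 + e)) = phi (f p) d + phi (f p) (a + b + d0 + e).
  by rewrite linearD.
have dtr : phi (f p) d \in transversal_bundle str ltr p.
  have [E _ _] := cr_phi_D' HM p.
  have : phi (f p) d \in (phi (f p) @: D' p)%VS by exact: memv_img.
  rewrite E addvC; apply/subvP; apply: addvS => //; exact: cr_L1_sub HM p.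
have pz := daddv_pi_eq0 (transversal_tangent_disjoint p) (phi_D_nu_tangent inD).
have pd := daddv_pi_id (transversal_tangent_disjoint p) dtr.
have pe (u v : 'rV[R]_n.*2.+1) : proj p (u + v) = proj p u + proj p v by rewrite linearD.
rewrite pe pd pz addr0 => d00.
have := phi_sq ct (f p) d; rewrite d00 linear0 => /esym/eqP.
rewrite addrC subr_eq0 => /eqP <-.
rewrite memvD // /D_nu; apply: (subvP (addvSr _ _)).
by rewrite memvZ // memv_line.
Qed.

End CR.
(** * Integrability *)

Theorem theorem4p6 (R : realType) (n k q r : nat)
    (N : manifold R n.*2.+1)
    (g : N -> bilinear_form R n.*2.+1)
    (nab nabs : (N -> 'rV[R]_n.*2.+1) -> (N -> 'rV[R]_n.*2.+1) ->
                N -> 'rV[R]_n.*2.+1)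
    (phi : N -> 'End('rV[R]_n.*2.+1)) (nu : N -> 'rV[R]_n.*2.+1)
    (eta : N -> 'Hom('rV[R]_n.*2.+1, R^o))
    (HN : indefinite_kenmotsu_statistical q g nab nabs phi nu eta)
    (M : manifold R k) (f : M -> N)
    (scr str ltr D0 D' L1 : M -> {vspace 'rV[R]_n.*2.+1})
    (HM : contact_CR_lightlike f g phi nu r scr str ltr D0 D' L1)
    (D Ds : (M -> 'rV[R]_k) -> (M -> 'rV[R]_n.*2.+1) -> M -> 'rV[R]_n.*2.+1)
    (HD : induced_connection f nab D) (HDs : induced_connection f nabs Ds) :
  let h := second_form f str ltr D in
  let hs := second_form f str ltr Ds in
  integrable_distribution f (D_nu f g phi nu D0) <->
  (forall X Y : M -> 'rV[R]_k,
     section_in f (D_nu f g phi nu D0) X ->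
     section_in f (D_nu f g phi nu D0) Y ->
     forall p : M,
       h X (phi_push f phi Y) p + hs X (phi_push f phi Y) p
       = h Y (phi_push f phi X) p + hs Y (phi_push f phi X) p).
Proof.
move=> h hs.
have sf : smooth_map f by have [] := ll_submanifold (cr_lightlike HM).
have cD := induced_conn HD; have cDs := induced_conn HDs.
have Ht := stat_torsion_free (ks_statistical HN).
have Hts := dual_torsion_free (ks_metric HN) (ks_statistical HN).
have key X Y p : section_in f (D_nu f g phi nu D0) X ->
    section_in f (D_nu f g phi nu D0) Y ->
    h X (phi_push f phi Y) p + hs X (phi_push f phi Y) p
    - (h Y (phi_push f phi X) p + hs Y (phi_push f phi X) p)
    = 2 *: daddv_pi (transversal_bundle str ltr p) (tangent_bundle f p)
             (phi (f p) (tmap f p (lie_bracket X Y p))).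
  move=> [sX XD] [sY YD].
  rewrite /h /hs /second_form -!linearD /= -linearB /=.
  rewrite /phi_push.
  rewrite (phi_along HN sf HD HDs p sX (smooth_section_push sf sY)).
  rewrite (phi_along HN sf HD HDs p sY (smooth_section_push sf sX)).
  have T1 := torsion_along sf cD (induced_compat HD) Ht p sX sY.
  have T2 := torsion_along sf cDs (induced_compat HDs) Hts p sX sY.
  rewrite opprD addrACA -linearB opprD addrACA T1 T2.
  (* The correction terms of phi_along are tangent to M. *)
  rewrite linearD /= [X in _ + X](_ : _ = 0); last first.
    apply: (daddv_pi_eq0 (transversal_tangent_disjoint HN HM p)).
    have TX := phi_D_nu_tangent HN HM (XD p).
    have TY := phi_D_nu_tangent HN HM (YD p).
    have Tn := cr_nu_tangent HM p.
    by rewrite -scalerBr memvZ // memvB // memvB // memvZ.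
  by rewrite addr0 -mulr2n -scaler_nat !linearZ.
have wT X Y p : tmap f p (lie_bracket X Y p) \in tangent_bundle f p.
  exact: memv_img (memvf _).
split=> H X Y HX HY p.
  apply/eqP; rewrite -subr_eq0 key //.
  have /(proj_phi_eq0 HN HM (wT X Y p)) -> := H X Y HX HY p.
  by rewrite scaler0.
apply/(proj_phi_eq0 HN HM (wT X Y p)).
have := key X Y p HX HY; rewrite H // subrr => /esym/eqP.
by rewrite scaler_eq0 pnatr_eq0 /= => /eqP.
Qed.
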